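(* Let $0<\alpha<\frac12$. There exists a countable family $F\subset\mathcal S_\alpha$ such that $\sup_{f\in F}L^f_1=\infty$ almost surely.
   Context: $W=(W_t)_{t\ge 0}$ is a one-dimensional Brownian motion started at $0$. For $\alpha\in(0,1]$, $\mathcal S_\alpha$ is the set of (deterministic) functions $f:[0,1]\to\mathbb R$ with $\sup_{0\le t\le 1}|f(t)|\le 1$ and $|f(s)-f(t)|\le|s-t|^\alpha$ for all $s,t\in[0,1]$. For measurable $f:[0,1]\to\mathbb R$ and $\varepsilon>0$ put $D^f_t(\varepsilon)=\frac1{2\varepsilon}\int_0^t\mathbf 1_{(f(s)-\varepsilon,f(s)+\varepsilon)}(W_s)\,ds$. The local time $L^f=(L^f_t)_{0\le t\le1}$ of $W$ along the curve $f$ is the nondecreasing continuous process (unique up to indistinguishability) such that $\mathbb E\big[\sup_{0\le t\le1}|D^f_t(\varepsilon)-L^f_t|^2\big]\to0$ as $\varepsilon\to0$. *)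

(* Defs.v *)
From HB Require Import structures.
From mathcomp Require Export all_boot all_order all_algebra.
From mathcomp Require Export all_classical all_reals all_analysis.
Export Order.TTheory GRing.Theory Num.Theory.
Export numFieldNormedType.Exports.

Set Implicit Arguments.
Unset Strict Implicit.
Unset Printing Implicit Defensive.

Local Open Scope classical_set_scope.
Local Open Scope ring_scope.

(* Functions on [0, 1] and processes indexed by [0, +oo[ or [0, 1] are total
   functions of a real argument; only their values on these sets are
   constrained or used. *)

(* Mutual independence of X_0, ..., X_(n-1): taking some of the A i to be setT
   gives the product rule for every subfamily. *)
Definition mutually_independent (d : measure_display) (T : measurableType d)
    (R : realType) (P : probability T R) (n : nat) (X : 'I_n -> T -> R) : Prop :=
  forall A : 'I_n -> set R, (forall i, measurable (A i)) ->
    (P (\bigcap_(i in [set: 'I_n]) (X i @^-1` A i))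
       = \prod_(i < n) P (X i @^-1` A i))%E.

(* [normal_prob] takes the standard deviation, not the variance. *)
Record brownian_motion (d : measure_display) (T : measurableType d)
    (R : realType) (P : probability T R) (W : R -> T -> R) : Prop := {
  bm_measurable : forall t : R, 0 <= t -> measurable_fun setT (W t) ;
  bm_start : {ae P, forall w, W 0 w = 0} ;
  bm_independent_increments : forall (n : nat) (t : nat -> R),
    0 <= t 0%N -> nondecreasing_seq t ->
    mutually_independent P
      (fun (i : 'I_n) (w : T) => W (t i.+1) w - W (t i) w) ;
  bm_gaussian_increments : forall s t : R, 0 <= s -> s < t ->
    forall A : set R, measurable A ->
      pushforward P (fun w => W t w - W s w) A
        = normal_prob 0 (Num.sqrt (t - s)) A ;
  bm_continuous : forall w, {within `[0, +oo[, continuous (fun t => W t w)}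
}.

Definition holder_ball (R : realType) (alpha : R) : set (R -> R) :=
  [set f | (forall t : R, t \in `[0, 1] -> `|f t| <= 1) /\
           (forall s t : R, s \in `[0, 1] -> t \in `[0, 1] ->
              `|f s - f t| <= `|s - t| `^ alpha)].

Definition occupation_density (T : Type) (R : realType) (W : R -> T -> R)
    (f : R -> R) (eps t : R) (w : T) : R :=
  (2 * eps)^-1 *
  \int[lebesgue_measure]_(s in `[0, t]) \1_(`]f s - eps, f s + eps[) (W s w).

Record local_time (d : measure_display) (T : measurableType d)
    (R : realType) (P : probability T R) (W : R -> T -> R) (f : R -> R)
    (L : R -> T -> R) : Prop := {
  lt_measurable : forall t : R, t \in `[0, 1] -> measurable_fun setT (L t) ;
  lt_nondecreasing : forall w,
    {in `[0, 1] &, {homo (fun t : R => L t w) : s t / s <= t}} ;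
  lt_continuous : forall w, {within `[0, 1], continuous (fun t => L t w)} ;
  lt_cvg :
    (\int[P]_w ereal_sup
       [set (`|occupation_density W f eps t w - L t w| ^+ 2)%:E | t in `[0%R, 1%R]])%E
    @[eps --> 0^'+] --> 0%E
}.

(* Main.v *)
(* For each [m], a countable exhaustion yields a sequence [G m] in the
   Hölder ball such that every other [g] satisfies [L^g_1 <= m] almost
   surely on the event [B m] that [L^f_1 <= m] for all [f] in the range of
   [G m].  Suppose that [B m] is not null.  The occupation time of the
   band of radius [eps] around [f] is, by Tonelli, bounded by the integral
   over [|a| <= 2 * eps] of the occupation densities of [W] along the
   curves [f + a]; these converge to [L^(f + a)_1], and dominated
   convergence bounds the time spent in the band by [4 * eps * (m + 2)]
   almost surely on [B m].  Since [alpha < 1/2], almost every path is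
   [alpha]-Hölder with constant 1 on some [0, rho] (Kolmogorov's
   chaining), so the path stopped at [rho] lies in the Hölder ball, and a
   countable dense family contains, for every [eps], a curve that stays
   within [eps] of [W] up to time [rho]; the time spent in its band does
   not tend to 0 with [eps], a contradiction. *)
Require Import Defs.
From mathcomp Require Import ring lra measurable_realfun.

Set Implicit Arguments.
Unset Strict Implicit.
Unset Printing Implicit Defensive.

Local Open Scope classical_set_scope.
Local Open Scope ring_scope.

(** * Essential intersections by countable exhaustion *)

(** The infimum of the probabilities of countable intersections is attained, by merging nearly
    minimal sequences. Intersecting a minimiser with one more [E i] cannot lower its probability, so
    it lies almost surely in [E i]. *)
Lemma exists_countable_ess_bigcap (d : measure_display) (T : measurableType d)
    (R : realType) (P : probability T R) (J : Type) (G : set J)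
    (E : J -> set T) :
  G !=set0 -> (forall i, G i -> measurable (E i)) ->
  exists F : nat -> J, (forall k, G (F k)) /\
    forall i, G i -> P ((\bigcap_k E (F k)) `\` E i) = 0%E.
Proof.
move=> [i0 Gi0] mE.
pose S := [set P (\bigcap_k E (F k)) | F in [set F : nat -> J | forall k, G (F k)]].
have mF (F : nat -> J) : (forall k, G (F k)) -> measurable (\bigcap_k E (F k)).
  by move=> GF; apply: bigcap_measurableType => k _; exact/mE/GF.
have Sge0 : (0 <= ereal_inf S)%E.
  by apply: le_ereal_inf_tmp => _ [F GF <-].
have Sfin : ereal_inf S \is a fin_num.
  rewrite ge0_fin_numE//; apply: (@le_lt_trans _ _ (P (\bigcap_(k in @setT nat) E i0))).
    by apply: ereal_inf_lbound; exists (fun=> i0).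
  by rewrite (le_lt_trans (probability_le1 _ _)) ?ltry//; apply: (mF (fun=> i0)).
have /choice[Fs FsP] : forall n : nat, exists F : nat -> J, (forall k, G (F k)) /\
    (P (\bigcap_k E (F k)) < ereal_inf S + (n.+1%:R^-1)%:E)%E.
  move=> n; have n0 : 0 < n.+1%:R^-1 :> R by rewrite invr_gt0.
  have [_ [F GF <-] FS] := lb_ereal_inf_adherent n0 Sfin.
  by exists F.
(* [F] minimises the probability of the intersection. *)
pose F k := if @unpickle (nat * nat)%type k is Some (n, j) then Fs n j else i0.
have GF k : G (F k).
  by rewrite /F; case: unpickle => // -[n j]; exact: (FsP n).1.
have FS : (P (\bigcap_k E (F k)) <= ereal_inf S)%E.
  apply/lee_addgt0Pr => e e0.
  have [n ne] : exists n : nat, n.+1%:R^-1 < e.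
    have /cvgrPdist_lt/(_ e e0)[N _ HN] := @cvg_harmonic R.
    by exists N; have := HN N (leqnn N); rewrite /= sub0r normrN ger0_norm// invr_ge0.
  apply: (@le_trans _ _ (ereal_inf S + (n.+1%:R^-1)%:E)%E); last first.
    by rewrite leeD2l// lee_fin ltW.
  apply: (le_trans _ (ltW (FsP n).2)).
  apply: le_measure; rewrite ?inE; [exact: mF|exact/mF/(FsP n).1|].
  move=> w FEw j _; have := FEw (pickle (n, j)) I.
  by rewrite /F pickleK.
exists F; split=> // i Gi; set A := \bigcap_k E (F k) in FS *.
have mA : measurable A by exact: mF.
rewrite measureD//; [|exact: mE|]; last first.
  by rewrite (le_lt_trans (probability_le1 _ _)) ?ltry.
(* Prepending [i] to [F] gives a competitor in [S], whose intersection is that of [A] with [E i]. *)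
have AE : (ereal_inf S <= P (A `&` E i))%E.
  apply: ereal_inf_lbound; exists (fun k => if k is k'.+1 then F k' else i).
    by case.
  congr (P _); apply/seteqP; split=> w.
    by move=> Aw; split; [move=> k _; exact: (Aw k.+1)|exact: (Aw 0%N)].
  by move=> [Aw Eiw] [|k] _ //=; exact: Aw.
have PAE : P (A `&` E i) = P A.
  apply/eqP; rewrite eq_le (le_trans FS AE) andbT.
  apply: le_measure; rewrite ?inE//.
  by apply: measurableI => //; exact: mE.
by rewrite [X in (_ - X)%E]PAE subee// fin_num_measure.
Qed.

(** * Local Hölder continuity of Brownian paths *)

Section dyadic_chaining.
Variables (R : realType) (g : R -> R) (q : R) (N : nat).
Hypothesis q01 : 0 < q < 1.
Hypothesis cg : continuous g.
Hypothesis dyadic_incr : forall n k : nat, (N <= n)%N -> (k < 2 ^ n)%N ->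
  `|g (k.+1%:R / 2 ^+ n) - g (k%:R / 2 ^+ n)| <= q ^+ n.

(** [dya n t] is the last dyadic point of level [n] not exceeding [t]; these points form the chain
    that leads to [t]. *)
Let idx (n : nat) (t : R) : nat := Num.trunc (2 ^+ n * t).
Let dya (n : nat) (t : R) : R := (idx n t)%:R / 2 ^+ n.

Let idx_itv n t : 0 <= t -> (idx n t)%:R <= 2 ^+ n * t < (idx n t).+1%:R.
Proof. by move=> t0; apply: truncn_itv; rewrite mulr_ge0// exprn_ge0. Qed.

Let idx_le n t : 0 <= t -> t <= 1 -> (idx n t <= 2 ^ n)%N.
Proof.
move=> t0 t1; have /andP[+ _] := idx_itv n t0.
move=> /le_trans/(_ (_ : _ <= 2 ^+ n))-/(_ _)/wrap[].
  by rewrite ler_piMr// exprn_ge0.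
by rewrite -natrX ler_nat.
Qed.

(** From level [n] to [n.+1] the index becomes its double or its double plus one, so the chain
    either stays or crosses a single dyadic interval of level [n.+1]. *)
Let dya_step n t : (N <= n)%N -> 0 <= t -> t <= 1 ->
  `|g (dya n.+1 t) - g (dya n t)| <= q ^+ n.+1.
Proof.
move=> Nn t0 t1.
have q0 : 0 < q by case/andP: q01.
have dyaE : dya n t = (2 * idx n t)%:R / 2 ^+ n.+1.
  by rewrite /dya natrM exprS -mulf_div divff ?mul1r// pnatr_eq0.
have /andP[a1 a2] := idx_itv n t0.
have /andP[b1 b2] := idx_itv n.+1 t0.
have lo : (2 * idx n t < (idx n.+1 t).+1)%N.
  rewrite -(ltr_nat R) natrM (le_lt_trans _ b2)// exprS -mulrA.
  by rewrite ler_pM2l.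
have hi : (idx n.+1 t < 2 * (idx n t).+1)%N.
  rewrite -(ltr_nat R) natrM (le_lt_trans b1)// exprS -mulrA.
  by rewrite ltr_pM2l.
have [E|E] : idx n.+1 t = (2 * idx n t)%N \/ idx n.+1 t = (2 * idx n t).+1.
  move: lo hi; rewrite mulnS ltnS leq_eqVlt => /predU1P[->|lo hi]; first by left.
  by right; apply/eqP; rewrite eqn_leq lo andbT -ltnS.
  by rewrite dyaE /dya E subrr normr0 exprn_ge0// ltW.
rewrite dyaE /dya E; apply: dyadic_incr; first exact: leqW.
by have := idx_le n.+1 t0 t1; rewrite E.
Qed.

(** The geometric tail [q ^+ n.+1 + q ^+ n.+2 + ...] equals [c * q ^+ n]. *)
Let c := q / (1 - q).

Let dya_steps n j t : (N <= n)%N -> 0 <= t -> t <= 1 ->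
  `|g (dya (n + j) t) - g (dya n t)| <= c * (q ^+ n - q ^+ (n + j)).
Proof.
move=> Nn t0 t1; elim: j => [|j IH].
  by rewrite addn0 !subrr normr0 mulr0.
have /andP[q0 q1] := q01.
rewrite addnS -(subrKA (g (dya (n + j) t))).
rewrite (le_trans (ler_normD _ _))//.
have -> : c * (q ^+ n - q ^+ (n + j).+1) =
    q ^+ (n + j).+1 + c * (q ^+ n - q ^+ (n + j)).
  by rewrite /c exprS; field; rewrite subr_eq0 gt_eqF.
by rewrite lerD// dya_step// (leq_trans Nn)// leq_addr.
Qed.

Let dya_lim t : 0 <= t -> dya n t @[n --> \oo] --> t.
Proof.
move=> t0; apply/cvgrPdist_le => e e0.
have := @cvg_geometric R 1 2^-1.
rewrite ger0_norm ?invr_ge0// invf_lt1 ?ltr1n// => /(_ isT).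
move=> /cvgrPdist_le/(_ e e0); apply: filterS => n.
rewrite sub0r normrN /geometric/= mul1r exprVn ger0_norm ?invr_ge0 ?exprn_ge0//.
apply: le_trans; have /andP[a1 a2] := idx_itv n t0.
have p0 : 0 < 2 ^+ n :> R by rewrite exprn_gt0.
rewrite /dya ger0_norm; last by rewrite subr_ge0 ler_pdivrMr// mulrC.
rewrite lerBlDr -[X in X + _]mul1r -mulrDl ler_pdivlMr// mulrC.
by rewrite ltW// (lt_le_trans a2)// -natr1 [leRHS]addrC.
Qed.

Let dya_approx n t : (N <= n)%N -> 0 <= t -> t <= 1 ->
  `|g t - g (dya n t)| <= c * q ^+ n.
Proof.
move=> Nn t0 t1; have /andP[q0 q1] := q01.
have c0 : 0 <= c by apply: divr_ge0; rewrite ?subr_ge0 ltW.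
apply/ler_addgt0Pr => e e0.
have : g (dya m t) @[m --> \oo] --> g t.
  by apply: (cvg_comp (dya ^~ t) g); [exact: dya_lim|exact: cg].
move=> /cvgrPdist_le/(_ e e0)[m _ /(_ (n + m)%N (leq_addl _ _))/= Hm].
rewrite -(subrKA (g (dya (n + m) t))) (le_trans (ler_normD _ _))// addrC lerD//.
by rewrite (le_trans (dya_steps _ _ _ _))// ler_wpM2l// gerBl exprn_ge0// ltW.
Qed.

(** At level [n] the dyadic points below [s] and [t] coincide or are neighbours, which costs at most
    [q ^+ n]; each of the two chains from there to [s] and [t] costs at most [c * q ^+ n]. *)
Lemma dyadic_chaining n s t : (N <= n)%N -> 0 <= s -> s <= t -> t <= 1 ->
  t - s <= (2 ^+ n)^-1 -> `|g t - g s| <= (1 + 2 * c) * q ^+ n.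
Proof.
move=> Nn s0 st t1 ts; have /andP[q0 q1] := q01.
have t0 := le_trans s0 st; have s1 := le_trans st t1.
have p0 : 0 < 2 ^+ n :> R by rewrite exprn_gt0.
have dd : `|g (dya n t) - g (dya n s)| <= q ^+ n.
  have /andP[a1 a2] := idx_itv n t0.
  have /andP[b1 b2] := idx_itv n s0.
  have lo : (idx n s < (idx n t).+1)%N.
    by rewrite -(ltr_nat R) (le_lt_trans b1)// (le_lt_trans _ a2)// ler_pM2l.
  have hi : (idx n t < (idx n s).+2)%N.
    rewrite -(ltr_nat R) (le_lt_trans a1)//.
    rewrite -[ltRHS]natr1 -ltrBlDr (le_lt_trans _ b2)// lerBlDr -lerBlDl -mulrBr.
    by rewrite mulrC -ler_pdivlMr// div1r.
  have [E|E] : idx n t = idx n s \/ idx n t = (idx n s).+1.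
    move: lo hi; rewrite ltnS leq_eqVlt => /predU1P[->|lo hi]; first by left.
    by right; apply/eqP; rewrite eqn_leq lo andbT -ltnS.
    by rewrite /dya E subrr normr0 exprn_ge0// ltW.
  rewrite /dya E; apply: dyadic_incr => //.
  by have := idx_le n t0 t1; rewrite E.
have := dya_approx Nn t0 t1; have := dya_approx Nn s0 s1; rewrite distrC.
move=> es et.
rewrite -(subrKA (g (dya n t))) (le_trans (ler_normD _ _))//.
rewrite -[g (dya n t) - _](subrKA (g (dya n s))).
rewrite (le_trans (lerD (lexx _) (ler_normD _ _)))//.
rewrite (le_trans (lerD et (lerD dd es)))//.
by rewrite le_eqVlt; apply/orP; left; apply/eqP; ring.
Qed.

End dyadic_chaining.

Lemma holder_of_dyadic_increments (R : realType) (g : R -> R) (q alpha : R)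
    (N : nat) : 0 < q -> 0 <= alpha -> q * 2 `^ alpha < 1 -> continuous g ->
  (forall n k : nat, (N <= n)%N -> (k < 2 ^ n)%N ->
     `|g (k.+1%:R / 2 ^+ n) - g (k%:R / 2 ^+ n)| <= q ^+ n) ->
  exists2 delta : R, 0 < delta <= 1 &
    forall s t, s \in `[0, delta] -> t \in `[0, delta] ->
      `|g s - g t| <= `|s - t| `^ alpha.
Proof.
move=> q0 a0 qa cg Hg.
have p1 : 1 <= 2 `^ alpha :> R by rewrite -[leLHS](powRr0 2) ler_powR// ler1n.
have q1 : q < 1 by rewrite (le_lt_trans _ qa)// ler_peMr// ltW.
have q01 : 0 < q < 1 by rewrite q0.
set C := 1 + 2 * (q / (1 - q)).
have C0 : 0 < C.
  by rewrite ltr_pwDl// mulr_ge0//; apply: divr_ge0; rewrite ?subr_ge0 ltW.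
pose r := q * 2 `^ alpha.
have r0 : 0 < r by rewrite mulr_gt0// powR_gt0.
have [M NM HM] : exists2 M, (N <= M)%N &
    forall n, (M <= n)%N -> C * r ^+ n * 2 `^ alpha <= 1.
  have e0 : 0 < (C * 2 `^ alpha)^-1 by rewrite invr_gt0 mulr_gt0 ?powR_gt0.
  have := @cvg_geometric R 1 r; rewrite gtr0_norm// => /(_ qa).
  move=> /cvgrPdist_le/(_ _ e0)[M _ HM]; exists (maxn N M); first exact: leq_maxl.
  move=> n; rewrite geq_max => /andP[_ Mn]; have := HM n Mn.
  rewrite sub0r normrN /geometric/= mul1r gtr0_norm ?exprn_gt0// => h.
  by rewrite mulrAC -ler_pdivlMl ?mulr1// mulr_gt0// powR_gt0.
exists (2 ^+ M)^-1.
  by rewrite invr_gt0 exprn_gt0//= invf_le1 ?exprn_gt0// exprn_ege1// ler1n.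
have main s t : 0 <= s -> s <= t -> t <= (2 ^+ M)^-1 ->
    `|g t - g s| <= (t - s) `^ alpha.
  move=> s0 st tM.
  have [->|nst] := eqVneq s t; first by rewrite subrr normr0 powR_ge0.
  have ts0 : 0 < t - s by rewrite subr_gt0 lt_neqAle nst.
  have tsM : t - s <= (2 ^+ M)^-1 by rewrite (le_trans _ tM)// gerBl.
  (* The least [n >= M] with [2 ^- n.+1 <= t - s]: either [n = M], where [tsM] gives the upper
     bound, or minimality excludes [n - 1] and gives it. *)
  have [n /andP[Mn tsn] nmax] : exists2 n, (M <= n)%N && (t - s <= (2 ^+ n)^-1) &
      (2 ^+ n.+1)^-1 <= t - s.
    have ex : exists n, (M <= n)%N && ((2 ^+ n.+1)^-1 <= t - s).
      have := @cvg_geometric R 1 2^-1.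
      rewrite ger0_norm ?invr_ge0// invf_lt1 ?ltr1n// => /(_ isT).
      move=> /cvgrPdist_le/(_ _ ts0)[m _ Hm]; exists (maxn M m).
      rewrite leq_maxl/=; have := Hm (maxn M m).+1.
      rewrite /= sub0r normrN mul1r exprVn ger0_norm ?invr_ge0 ?exprn_ge0//.
      by apply; rewrite leqW// leq_maxr.
    case: (ex_minnP ex) => n /andP[Mn tsn] nmin.
    exists n => //; rewrite Mn/=.
    move: Mn; rewrite leq_eqVlt => /predU1P[<-//|].
    case: n tsn nmin => // n tsn nmin; rewrite ltnS => Mn.
    by rewrite leNgt; apply/negP => /ltW lt; have := nmin n; rewrite Mn lt ltnn => /(_ isT).
  have t1 : t <= 1.
    by rewrite (le_trans tM)// invf_le1 ?exprn_gt0// exprn_ege1// ler1n.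
  apply: (le_trans (dyadic_chaining q01 cg Hg (leq_trans NM Mn) s0 st t1 tsn)).
  apply: (@le_trans _ _ (((2 ^+ n.+1)^-1) `^ alpha)); last first.
    by rewrite ge0_ler_powR// ?nnegrE ?invr_ge0 ?exprn_ge0// ltW.
  have -> : ((2 ^+ n.+1)^-1) `^ alpha = ((2 `^ alpha) ^+ n.+1)^-1.
    rewrite -[2 ^+ n.+1]powR_mulrn// -powRN -powRrM mulNr powRN mulrC powRrM.
    by rewrite powR_mulrn// powR_ge0.
  rewrite -[leRHS]mul1r ler_pdivlMr ?exprn_gt0 ?powR_gt0//.
  rewrite -/C exprSr [leLHS]mulrA -(mulrA C) -exprMn; exact: HM.
move=> s t; rewrite !in_itv/= => /andP[s0 s1] /andP[t0 t1].
have [st|ts] := leP s t.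
  by rewrite distrC [`|s - t|]distrC (ger0_norm (_ : 0 <= t - s)) ?subr_ge0// main.
by rewrite (ger0_norm (_ : 0 <= s - t)) ?subr_ge0 ?main// ltW.
Qed.

(** * Gaussian tails and Borel-Cantelli for dyadic increments *)

(** On the tail the density is at most the stated constant times the Gaussian density of doubled
    variance, whose integral is 1. This loses half of the exponent but requires no tail integral. *)
Lemma normal_prob_tail (R : realType) (s x : R) : 0 < s -> 0 <= x ->
  (normal_prob 0 s [set y : R | (x < `|y|)%R]
    <= (Num.sqrt 2 * expR (- (x ^+ 2 / (4 * s ^+ 2))))%:E)%E.
Proof.
move=> s0 x0; set D := [set y : R | _].
have mD : measurable D.
  rewrite (_ : D = (@Num.norm _ R) @^-1` `]x, +oo[); last first.
    by apply/seteqP; split=> y /=; rewrite in_itv/= andbT.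
  by rewrite -[X in measurable X]setTI; exact: measurable_realfun.normr_measurable.
pose c := Num.sqrt 2 * expR (- (x ^+ 2 / (4 * s ^+ 2))).
pose s2 := Num.sqrt 2 * s.
have s20 : 0 < s2 by rewrite mulr_gt0// sqrtr_gt0.
have c0 : 0 <= c by rewrite mulr_ge0 ?sqrtr_ge0// expR_ge0.
have mpdf (t : R) : measurable_fun [set: R] (fun y : R => (normal_pdf 0 t y)%:E).
  by apply/measurable_EFinP; exact: measurable_normal_pdf.
rewrite /normal_prob.
apply: (@le_trans _ _ (\int[lebesgue_measure]_(y in D)
    (c%:E * (normal_pdf 0 s2 y)%:E))%E).
  apply: ge0_le_integral => //.
  - by move=> y _; rewrite lee_fin normal_pdf_ge0.
  - exact: measurable_funTS (mpdf _).
  - by apply: measurable_funTS; exact: measurable_funeM (mpdf _).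
  move=> y; rewrite /D/= => xy; rewrite -EFinM lee_fin.
  rewrite !normal_pdfE ?gt_eqF// /normal_peak /normal_fun !subr0.
  have -> : Num.sqrt (s2 ^+ 2 * pi *+ 2) = Num.sqrt 2 * Num.sqrt (s ^+ 2 * pi *+ 2).
    rewrite -sqrtrM//; congr Num.sqrt.
    rewrite /s2 exprMn sqr_sqrtr//; ring.
  rewrite /c [leRHS](_ : _ = (Num.sqrt (s ^+ 2 * pi *+ 2))^-1 *
     (expR (- (x ^+ 2 / (4 * s ^+ 2))) * expR (- y ^+ 2 / (s2 ^+ 2 *+ 2)))); last first.
    rewrite invfM; field.
    by rewrite !gt_eqF ?sqrtr_gt0// mulrn_wgt0// mulr_gt0 ?pi_gt0// exprn_gt0.
  rewrite ler_wpM2l ?invr_ge0 ?sqrtr_ge0// -expRD ler_expR.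
  rewrite /s2 exprMn sqr_sqrtr//.
  (* The exponent splits into two equal halves: one is bounded through [x < |y|], the other is the
     exponent of the wider Gaussian. *)
  have -> : - y ^+ 2 / (s ^+ 2 *+ 2) =
      - (y ^+ 2 / (4 * s ^+ 2)) + - y ^+ 2 / (2 * s ^+ 2 *+ 2).
    by field; rewrite gt_eqF.
  rewrite lerD2r lerN2 ler_wpM2r//; first by rewrite invr_ge0 mulr_ge0 ?sqr_ge0.
  by rewrite -(real_normK (num_real y)) lerXn2r ?nnegrE// ltW.
have pdf0 y : (0 <= (normal_pdf 0 s2 y)%:E)%E by rewrite lee_fin normal_pdf_ge0.
have -> : (\int[lebesgue_measure]_(y in D) (c%:E * (normal_pdf 0 s2 y)%:E) =
    c%:E * \int[lebesgue_measure]_(y in D) (normal_pdf 0 s2 y)%:E)%E.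
  by apply: ge0_integralZl_EFin => //; exact: measurable_funTS (mpdf _).
rewrite -[leRHS]mule1; apply: lee_wpmul2l; rewrite ?lee_fin//.
rewrite -[leRHS](@integral_normal_pdf R 0 s2).
apply: ge0_subset_integral => //; exact: mpdf.
Qed.

(** With [k = K.+1] such that [r ^+ k >= 4], the inequality [expR y >= (y / k) ^+ k] at
    [y = r ^+ n / 4] produces a factor [4 ^+ n]. The rate 4 outweighs the [2 ^ n] intervals of level
    [n] and leaves a summable series. *)
Lemma expR_geometric_decay (R : realType) (r : R) : 1 < r ->
  exists2 C : R, 0 <= C & forall n : nat, expR (- (r ^+ n / 4)) <= C / 4 ^+ n.
Proof.
move=> r1; have r0 : 0 < r by rewrite (lt_trans _ r1).
have [K rK] : exists K : nat, 4 <= r ^+ K.+1.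
  have ri : `|r^-1| < 1 by rewrite gtr0_norm ?invr_gt0// invf_lt1.
  have e0 : 0 < 4^-1 :> R by rewrite invr_gt0.
  have /cvgrPdist_le/(_ _ e0)[m _ /(_ m.+1 (leqnSn m))] := @cvg_geometric R 1 _ ri.
  rewrite sub0r normrN /geometric/= mul1r exprVn gtr0_norm ?invr_gt0 ?exprn_gt0//.
  by rewrite lef_pV2 ?posrE ?exprn_gt0// => h; exists m.
pose k : R := K.+1%:R.
have k0 : 0 < k by rewrite ltr0n.
exists ((4 * k) ^+ K.+1); first by rewrite exprn_ge0// mulr_ge0// ltW.
move=> n; set y := r ^+ n / 4.
have y0 : 0 < y by rewrite divr_gt0// exprn_gt0.
have yk : (y / k) ^+ K.+1 <= expR y.
  have -> : expR y = expR (y / k) ^+ K.+1.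
    by rewrite -expRM_natr divfK// gt_eqF.
  have yk0 : 0 <= y / k by rewrite ltW// divr_gt0.
  apply: lerXn2r; rewrite ?nnegrE ?expR_ge0//.
  by rewrite (le_trans _ (expR_ge1Dx _))// lerDr.
rewrite expRN.
apply: (@le_trans _ _ (((y / k) ^+ K.+1)^-1)).
  by rewrite lef_pV2 ?posrE ?expR_gt0// exprn_gt0// divr_gt0.
have -> : (y / k) ^+ K.+1 = (r ^+ K.+1) ^+ n / (4 * k) ^+ K.+1.
  by rewrite /y -exprM mulnC exprM -expr_div_n; congr (_ ^+ _); field; rewrite gt_eqF.
rewrite invf_div ler_wpM2l//; first by rewrite exprn_ge0// mulr_ge0// ltW.
rewrite lef_pV2 ?posrE ?exprn_gt0//.
by apply: lerXn2r; rewrite ?nnegrE ?exprn_ge0// ltW.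
Qed.

Section brownian_modulus.
Context (R : realType) (d : measure_display) (T : measurableType d).
Context (P : probability T R) (W : R -> T -> R).
Hypothesis hW : brownian_motion P W.

Let mW (t : R) : 0 <= t -> measurable_fun setT (W t) := bm_measurable hW (t:=t).

(** Paths are continuous only within [[0, +oo[]; clamping the time at 0 gives a function continuous
    on the whole line, as the chaining and joint measurability arguments require. *)
Lemma brownian_continuous_max (w : T) : continuous (fun t : R => W (Num.max 0 t) w).
Proof.
have : {within `[0, +oo[, continuous (fun t => W t w)} by apply: (bm_continuous hW).
move=> /subspace_continuousP cW t.
have m0 (s : R) : `[0, +oo[%classic (Num.max 0 s).
  by rewrite /= in_itv/= andbT le_max lexx.
have cm : (fun s : R => Num.max 0 s) @ t --> Num.max 0 t.
  by apply: (@continuous_max R R (cst 0) id t); [exact: cst_continuous|exact: cvg_id].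
move=> B /(cW _ (m0 t)) wB.
have {}wB : \forall s \near t,
    `[0, +oo[%classic (Num.max 0 s) -> B (W (Num.max 0 s) w).
  exact: cm _ wB.
by suff: \forall s \near t, B (W (Num.max 0 s) w) by []; apply: filterS wB => s; apply.
Qed.

Let dyadic_bad (q : R) (n k : nat) :=
  [set w | q ^+ n < `|W (k.+1%:R / 2 ^+ n) w - W (k%:R / 2 ^+ n) w|].

Let measurable_dyadic_bad q n k : measurable (dyadic_bad q n k).
Proof.
have m0 (j : nat) : measurable_fun setT (W (j%:R / 2 ^+ n)).
  by apply: mW; rewrite divr_ge0 ?exprn_ge0.
rewrite (_ : dyadic_bad q n k =
  (fun w => `|W (k.+1%:R / 2 ^+ n) w - W (k%:R / 2 ^+ n) w|) @^-1` `]q ^+ n, +oo[).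
  rewrite -[X in measurable X]setTI.
  have mf : measurable_fun setT
      (fun w => `|W (k.+1%:R / 2 ^+ n) w - W (k%:R / 2 ^+ n) w|).
    by apply: measurableT_comp; [exact: normr_measurable|exact: measurable_funB].
  exact: mf.
by apply/seteqP; split=> w /=; rewrite in_itv/= andbT.
Qed.

(** The increment has variance [2 ^- n], so the tail bound at [x = q ^+ n] has exponent
    [q ^+ (2 * n) * 2 ^+ n / 4]. *)
Let dyadic_bad_le (q : R) n k : 0 < q ->
  (P (dyadic_bad q n k) <=
   (Num.sqrt 2 * expR (- ((2 * q ^+ 2) ^+ n / 4)))%:E)%E.
Proof.
move=> q0; have p0 : 0 < 2 ^+ n :> R by rewrite exprn_gt0.
have lt : k%:R / 2 ^+ n < k.+1%:R / 2 ^+ n :> R.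
  by rewrite ltr_pM2r ?invr_gt0// ltr_nat.
have k0 : 0 <= k%:R / 2 ^+ n :> R by rewrite divr_ge0// ltW.
pose D := [set y : R | q ^+ n < `|y|].
have mD : measurable D.
  rewrite (_ : D = (@Num.norm _ R) @^-1` `]q ^+ n, +oo[); last first.
    by apply/seteqP; split=> y /=; rewrite in_itv/= andbT.
  by rewrite -[X in measurable X]setTI; exact: normr_measurable.
have -> : dyadic_bad q n k =
    (fun w => W (k.+1%:R / 2 ^+ n) w - W (k%:R / 2 ^+ n) w) @^-1` D by [].
have := bm_gaussian_increments hW k0 lt mD; rewrite /pushforward => ->.
have dE : k.+1%:R / 2 ^+ n - k%:R / 2 ^+ n = (2 ^+ n)^-1 :> R.
  by rewrite -mulrBl -natrB// subSnn mul1r.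
rewrite dE; set s := Num.sqrt _.
have s0 : 0 < s by rewrite sqrtr_gt0 invr_gt0.
apply: (le_trans (normal_prob_tail s0 _)); first by rewrite exprn_ge0// ltW.
rewrite lee_fin ler_wpM2l ?sqrtr_ge0// ler_expR lerN2 le_eqVlt; apply/orP; left.
rewrite /s sqr_sqrtr ?invr_ge0 ?ltW// exprMn -exprM mulnC exprM; apply/eqP.
by field; rewrite gt_eqF.
Qed.

(** Borel-Cantelli: by the union bound, the probability of a large increment at level [n] is at most
    a constant times [2 ^ n / 4 ^ n]. *)
Lemma brownian_dyadic_increments (q : R) : 0 < q -> 1 < 2 * q ^+ 2 ->
  {ae P, forall w, exists N, forall n k : nat, (N <= n)%N -> (k < 2 ^ n)%N ->
    `|W (k.+1%:R / 2 ^+ n) w - W (k%:R / 2 ^+ n) w| <= q ^+ n}.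
Proof.
move=> q0 q2; have [C C0 HC] := expR_geometric_decay q2.
pose A n := \big[setU/set0]_(k < 2 ^ n) dyadic_bad q n k.
have mA n : measurable (A n) by apply: bigsetU_measurable => k _.
pose K := Num.sqrt 2 * C * 2.
have K0 : 0 <= K by rewrite !mulr_ge0// sqrtr_ge0.
have PA n : (P (A n) <= (K / (2 ^ (n + 1))%:R)%:E)%E.
  apply: le_trans (Boole_inequality _ _) _ => //.
  apply: (@le_trans _ _ (\sum_(k < 2 ^ n) (Num.sqrt 2 * (C / 4 ^+ n))%:E)%E).
    apply: lee_sum => k _; apply: (le_trans (dyadic_bad_le _ _ q0)).
    by rewrite lee_fin ler_wpM2l ?sqrtr_ge0.
  rewrite sumEFin lee_fin big_const_ord iter_addr_0 le_eqVlt; apply/orP; left.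
  apply/eqP; rewrite -[LHS]mulr_natl /K addn1 !natrX exprS.
  have -> : 4 ^+ n = 2 ^+ n * 2 ^+ n :> R by rewrite -exprMn; congr (_ ^+ _); ring.
  by field; rewrite expf_neq0.
have limA : P (lim_sup_set A) = 0%E.
  apply: lim_sup_set_cvg0 => //.
  apply: (@le_lt_trans _ _ (\sum_(n <oo) (K / (2 ^ (n + 1))%:R)%:E)%E).
    by apply: lee_nneseries => [n _ _|n _]; [exact: measure_ge0|exact: PA].
  by rewrite (cvg_lim _ (@cvg_geometric_eseries_half R K 0))// ltry.
exists (lim_sup_set A); split=> //.
  apply: bigcap_measurableType => n _.
  by apply: bigcup_measurable => j _.
move=> w /= H; apply: contrapT => nl; apply: H.
have [N HN] : exists N, forall n, (N <= n)%N -> ~ A n w.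
  apply: contrapT => H; apply: nl => N _; apply: contrapT => H'.
  by apply: H; exists N => n Nn An; apply: H'; exists n.
exists N => n k Nn kn; rewrite leNgt; apply/negP => lt; apply: (HN n Nn).
by rewrite /A -bigcup_mkord; exists k.
Qed.

Lemma brownian_holder_near0 (alpha : R) : 0 < alpha < 2^-1 ->
  {ae P, forall w, exists2 delta : R, 0 < delta <= 1 &
    forall s t, s \in `[0, delta] -> t \in `[0, delta] ->
      `|W s w - W t w| <= `|s - t| `^ alpha}.
Proof.
move=> /andP[a0 a2].
pose gamma := (alpha + 2^-1) / 2.
pose q : R := 2 `^ (- gamma).
have q0 : 0 < q by rewrite powR_gt0.
have pow_lt1 (x : R) : x < 0 -> 2 `^ x < 1 :> R.
  by move=> x0; rewrite /powR pnatr_eq0/= expR_lt1 pmulr_llt0// ln_gt0// ltr1n.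
have q2 : 1 < 2 * q ^+ 2.
  rewrite -[ltRHS]invrK -[ltLHS]invr1 ltf_pV2 ?posrE// ?invr_gt0 ?mulr_gt0 ?exprn_gt0//.
  rewrite (_ : (2 * q ^+ 2)^-1 = 2 `^ (2 * gamma - 1)).
    by apply: pow_lt1; rewrite /gamma; lra.
  rewrite powRB ?pnatr_eq0 ?implybT// powRr1// /q -powR_mulrn ?powR_ge0//.
  rewrite -powRrM mulNr powRN invfM invrK mulrC; congr (_ `^ _ * _).
  by rewrite mulrC.
have qa : q * 2 `^ alpha < 1.
  rewrite -powRD ?pnatr_eq0 ?implybT//; apply: pow_lt1; rewrite /gamma; lra.
have := brownian_dyadic_increments q0 q2; apply: filterS => w [N HN].
have [|delta d01 Hd] := holder_of_dyadic_increments q0 (ltW a0) qa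
    (@brownian_continuous_max w) (N := N).
  move=> n k Nn kn; rewrite !max_r ?divr_ge0 ?exprn_ge0//; exact: HN.
exists delta => // s t sd td; have := Hd s t sd td.
by move: sd td; rewrite !in_itv/= => /andP[s0 _] /andP[t0 _]; rewrite !max_r.
Qed.

End brownian_modulus.

(** * Joint measurability and dense families of curves *)

Lemma truncn_grid_dist (R : realType) (n : nat) (t : R) : 0 <= t ->
  `|t - (Num.trunc (n.+1%:R * t))%:R / n.+1%:R| <= n.+1%:R^-1.
Proof.
move=> t0; have n0 : 0 < n.+1%:R :> R by rewrite ltr0n.
have nt0 : 0 <= n.+1%:R * t by rewrite mulr_ge0.
have /andP[a1 a2] := truncn_itv nt0.
rewrite ger0_norm; last by rewrite subr_ge0 ler_pdivrMr// [leRHS]mulrC.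
rewrite lerBlDr -[X in X + _]mul1r -mulrDl ler_pdivlMr// [leLHS]mulrC.
by rewrite ltW// (lt_le_trans a2)// -natr1 [leRHS]addrC.
Qed.

(** The process is the pointwise limit of its values at grid times; preimages under the discretised
    processes are countable unions of measurable rectangles. *)
Lemma measurable_fun_continuous_process (d : measure_display)
    (T : measurableType d) (R : realType) (X : R -> T -> R) :
  (forall t, 0 <= t -> measurable_fun setT (X t)) ->
  (forall w, continuous (fun t : R => X (Num.max 0 t) w)) ->
  measurable_fun [set: R * T] (fun p => X (Num.max 0 p.1) p.2).
Proof.
move=> mX cX.
pose r (n : nat) (t : R) : R := (Num.trunc (n.+1%:R * t))%:R / n.+1%:R.
have r0 n t : 0 <= r n t by rewrite divr_ge0.
apply: (@measurable_fun_cvg _ _ R setT (fun n p => X (r n p.1) p.2)).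
  move=> n _ B mB; rewrite setTI.
  have mtr : measurable_fun [set: R] (fun t : R => (Num.trunc (n.+1%:R * t))%:R : R).
    apply: nondecreasing_measurable => // s t st.
    by rewrite ler_nat le_truncn// ler_pM2l.
  rewrite (_ : _ @^-1` B = \bigcup_k
      ((fun t : R => (Num.trunc (n.+1%:R * t))%:R : R) @^-1` [set k%:R]
        `*` X (k%:R / n.+1%:R) @^-1` B)).
    apply: bigcup_measurable => k _; apply: measurableX.
      by rewrite -[X in measurable X]setTI; exact: mtr.
    by rewrite -[X in measurable X]setTI; apply: mX => //; rewrite divr_ge0.
  apply/seteqP; split=> [[t w]/= Bw|[t w] [k _ [/= tk Bw]]].
    by exists (Num.trunc (n.+1%:R * t)).
  by rewrite /r tk.
move=> [t w] _ /=.
have rt : r ^~ t @ \oo --> Num.max 0 t.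
  apply/cvgrPdist_lt => e e0.
  apply: filterS (near_infty_natSinv_lt (PosNum e0)) => n /=; apply: le_lt_trans.
  have [t0|t0] := leP 0 t; first exact: truncn_grid_dist.
  (* Truncation sends negative reals to 0, in agreement with the clamped time. *)
  rewrite /r (_ : Num.trunc _ = 0%N); first by rewrite mul0r subrr normr0 invr_ge0.
  by apply/truncn0Pn; rewrite -ltNge (lt_trans _ ltr01)// pmulr_rlt0.
have := cvg_comp (r ^~ t) (fun t : R => X (Num.max 0 t) w) rt (cX w _).
rewrite (max_r (_ : 0 <= Num.max 0 t)) ?le_max ?lexx//.
by apply: cvg_trans; apply: near_eq_cvg; apply: nearW => n /=; rewrite max_r.
Qed.

(** A grid size and a finite list of rationals encode approximate grid values. One function of [H]
    is chosen for each code that some function of [H] realises; by the Hölder bound, two functions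
    with the same code are uniformly close. *)
Lemma exists_dense_seq_holder_ball (R : realType) (alpha c : R) :
  0 < alpha -> 0 <= c ->
  let H : set (R -> R) :=
    holder_ball alpha `&` [set f | forall t, t \in `[0, 1] -> `|f t| <= c] in
  exists F : nat -> R -> R, (forall i, H (F i)) /\
    forall h, H h -> forall e, 0 < e ->
      exists i, forall t, t \in `[0, 1] -> `|F i t - h t| < e.
Proof.
move=> a0 c0 H.
have H0 : H (cst 0).
  split; last by move=> t _; rewrite normr0.
  split=> [t _|s t _ _]; first by rewrite normr0.
  by rewrite subrr normr0 powR_ge0.
pose close (n : nat) (q : seq rat) : set (R -> R) :=
  [set f | forall i, (i <= n.+1)%N -> `|f (i%:R / n.+1%:R) - ratr q`_i| < n.+1%:R^-1].
pose G n q := xget (cst 0) (H `&` close n q).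
have HG n q : H (G n q).
  by rewrite /G; case: xgetP => [f _ []|].
exists (fun i => if @unpickle (nat * seq rat)%type i is Some (n, q) then G n q else cst 0).
split; first by move=> i; case: unpickle => // -[n q].
move=> h Hh e e0.
(* Four errors of size [e / 4]: the oscillation of each function between [t] and its grid point, and
   the rational approximation of each grid value. The second term of [m] controls the
   oscillations. *)
pose e4 := e / 4; have e40 : 0 < e4 by rewrite divr_gt0.
pose m := Num.min e4 (e4 `^ alpha^-1).
have m0 : 0 < m by rewrite lt_min e40 powR_gt0.
have [n nm] : exists n : nat, n.+1%:R^-1 < m.
  have [N _ HN] := near_infty_natSinv_lt (PosNum m0).
  by exists N; apply: HN => /=.
have n0 : 0 < n.+1%:R :> R by rewrite ltr0n.
have /choice[u Hu] : forall i : nat, exists q : rat,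
    `|h (i%:R / n.+1%:R) - ratr q| < n.+1%:R^-1.
  move=> i; set y := h _.
  have [|q] := @rat_in_itvoo R (y - n.+1%:R^-1) (y + n.+1%:R^-1).
    by rewrite ltrD2l gtrN// invr_gt0.
  by rewrite in_itv/= => /andP[q1 q2]; exists q; rewrite distrC ltr_distl q1.
(* The list has [n.+2] entries because the grid contains both endpoints 0 and 1. *)
pose q := mkseq u n.+2.
have closeh : close n q h.
  by move=> i ni; rewrite /q nth_mkseq.
have [HGq closeG] : (H `&` close n q) (G n q).
  by apply: xgetPex; exists h.
exists (pickle (n, q)) => t t01; rewrite pickleK.
have /andP[t0 t1] : 0 <= t <= 1 by rewrite in_itv/= in t01.
pose i := Num.trunc (n.+1%:R * t).
have ni : (i <= n.+1)%N.
  by rewrite truncn_le_nat (le_lt_trans (_ : _ <= n.+1%:R)) ?ler_piMr// ltr_nat.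
have i01 : i%:R / n.+1%:R \in `[0 : R, 1].
  by rewrite in_itv/= divr_ge0//= ler_pdivrMr// mul1r ler_nat.
have small f : H f -> `|f t - f (i%:R / n.+1%:R)| < e4.
  move=> [[_ Hf] _]; apply: (le_lt_trans (Hf _ _ t01 i01)).
  apply: (@le_lt_trans _ _ (n.+1%:R^-1 `^ alpha)).
    apply: ge0_ler_powR; rewrite ?nnegrE ?invr_ge0//; first exact: ltW.
    exact: truncn_grid_dist.
  rewrite [ltRHS](_ : _ = (e4 `^ alpha^-1) `^ alpha); last first.
    by rewrite -powRrM mulVf ?gt_eqF// powRr1// ltW.
  apply: gt0_ltr_powR; rewrite ?nnegrE ?invr_ge0 ?powR_ge0//.
  by rewrite (lt_le_trans nm)// ge_min lexx orbT.
have ne4 : n.+1%:R^-1 < e4 by rewrite (lt_le_trans nm)// ge_min lexx.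
have h1 := small _ HGq; have h2 := small _ Hh.
have h3 := closeG i ni; have h4 := closeh i ni.
move: (G n q t) (G n q _) (h t) (h _) (ratr _) n.+1%:R^-1 h1 h2 h3 h4 ne4.
rewrite /e4 => a b a' b' z v; rewrite !ltr_norml.
move=> /andP[? ?] /andP[? ?] /andP[? ?] /andP[? ?] ?; apply/andP; split; lra.
Qed.

(** * Averages of occupation times *)

Lemma integral_xsection_ysection (d1 d2 : measure_display)
    (T1 : measurableType d1) (T2 : measurableType d2) (R : realType)
    (m1 : {sigma_finite_measure set T1 -> \bar R})
    (m2 : {sigma_finite_measure set T2 -> \bar R}) (E : set (T1 * T2)) :
  measurable E ->
  (\int[m1]_x m2 (xsection E x) = \int[m2]_y m1 (ysection E y))%E.
Proof.
move=> mE; have := indic_fubini_tonelli m1 m2 mE.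
by rewrite indic_fubini_tonelli_FE// indic_fubini_tonelli_GE.
Qed.

Section occupation_average.
Context (R : realType) (d : measure_display) (T : measurableType d).
Context (P : probability T R) (Y : R -> T -> R) (S : set R) (A : set T).
Hypothesis mY : measurable_fun [set: R * T] (fun p => Y p.1 p.2).
Hypothesis mS : measurable S.
Hypothesis mA : measurable A.

Local Notation mu := (@lebesgue_measure R).

Definition occupation_set (eta a : R) (w : T) : set R :=
  S `&` [set s | `|Y s w - a| < eta].

(** A single set of triples [((a, w), s)], from whose sections the joint measurability in level and
    path of the occupation time is read off. *)
Let bandX (I : set R) (eta : R) : set ((R * T) * R) :=
  [set q | I q.1.1 /\ A q.1.2 /\ S q.2 /\ `|Y q.2 q.1.2 - q.1.1| < eta].

Let measurable_bandX I eta : measurable I -> measurable (bandX I eta).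
Proof.
move=> mI.
have m11 : measurable_fun [set: (R * T) * R] (fun q => q.1.1).
  exact: measurableT_comp measurable_fst measurable_fst.
have m12 : measurable_fun [set: (R * T) * R] (fun q => q.1.2).
  exact: measurableT_comp measurable_snd measurable_fst.
have mYq : measurable_fun [set: (R * T) * R] (fun q => `|Y q.2 q.1.2 - q.1.1|).
  apply: measurableT_comp; first exact: normr_measurable.
  apply: measurable_funB => //.
  apply: (measurableT_comp mY (g := fun q : (R * T) * R => (q.2, q.1.2))).
  exact: measurable_fun_pair measurable_snd m12.
rewrite (_ : bandX I eta = ((fun q : (R * T) * R => q.1.1) @^-1` I) `&`
   (((fun q : (R * T) * R => q.1.2) @^-1` A) `&` ((snd @^-1` S) `&`
   ((fun q : (R * T) * R => `|Y q.2 q.1.2 - q.1.1|) @^-1` `]-oo, eta[)))).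
  do ?apply: measurableI; rewrite -[X in measurable X]setTI.
  - exact: m11.
  - exact: m12.
  - exact: measurable_snd.
  - exact: mYq.
by apply/seteqP; split=> q /=; rewrite in_itv/=.
Qed.

Let xsection_bandX I eta a w :
  xsection (bandX I eta) (a, w) =
    if (a \in I) && (w \in A) then occupation_set eta a w else set0.
Proof.
apply/seteqP; split=> s; rewrite /xsection/=.
  by move/set_mem => [/= aI [wA Hs]]; rewrite !mem_set.
by case: ifPn => // /andP[/set_mem aI /set_mem wA] Hs; apply/mem_set.
Qed.

Lemma measurable_occupation_set eta a w : measurable (occupation_set eta a w).
Proof.
apply: measurableI => //.
have mf : measurable_fun [set: R] (fun s => `|Y s w - a|).
  apply: measurableT_comp; first exact: normr_measurable.
  by apply: measurable_funB => //; exact: measurable_fun_pair1 mY.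
rewrite (_ : [set s | _] = (fun s => `|Y s w - a|) @^-1` `]-oo, eta[).
  by rewrite -[X in measurable X]setTI; exact: mf.
by apply/seteqP; split=> s /=; rewrite in_itv.
Qed.

Let measurable_occ_pair I eta : measurable I ->
  measurable_fun [set: R * T] (fun q => mu (xsection (bandX I eta) q)).
Proof. by move=> mI; apply: measurable_fun_xsection; exact: measurable_bandX. Qed.

Let band (eta a : R) : set (T * R) :=
  [set q | S q.2 /\ `|Y q.2 q.1 - a| < eta].

Let measurable_band eta a : measurable (band eta a).
Proof.
have mYq : measurable_fun [set: T * R] (fun q => `|Y q.2 q.1 - a|).
  apply: measurableT_comp; first exact: normr_measurable.
  apply: measurable_funB => //.
  apply: (measurableT_comp mY (g := fun q : T * R => (q.2, q.1))).
  exact: measurable_fun_pair measurable_snd measurable_fst.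
rewrite (_ : band eta a = (snd @^-1` S) `&`
   ((fun q : T * R => `|Y q.2 q.1 - a|) @^-1` `]-oo, eta[)).
  apply: measurableI; rewrite -[X in measurable X]setTI.
    exact: measurable_snd.
  exact: mYq.
by apply/seteqP; split=> q /=; rewrite in_itv/=.
Qed.

Lemma measurable_occupation eta a :
  measurable_fun setT (fun w => mu (occupation_set eta a w)).
Proof.
have := measurable_fun_xsection (@lebesgue_measure R) (measurable_band eta a).
apply: eq_measurable_fun => w _ /=; congr (mu _).
by apply/seteqP; split=> s; rewrite /xsection/=; [move/set_mem|move=> ?; apply/mem_set].
Qed.

Let integral_occ I eta a :
  (\int[P]_w mu (xsection (bandX I eta) (a, w)) =
   (fun a => \int[P]_(w in A) mu (occupation_set eta a w)) \_ I a)%E.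
Proof.
rewrite patchE; case: ifPn => aI.
  rewrite [RHS]integral_mkcond; apply: eq_integral => w _.
  by rewrite patchE xsection_bandX aI/=; case: ifP => //; rewrite measure0.
rewrite integral0_eq// => w _.
by rewrite xsection_bandX (negbTE aI)/= measure0.
Qed.

Lemma measurable_integral_occupation eta :
  measurable_fun [set: R] (fun a => \int[P]_(w in A) mu (occupation_set eta a w))%E.
Proof.
have := @measurable_fun_fubini_tonelli_F _ _ _ _ _ P _
   (measurable_occ_pair eta (@measurableT _ R)) (fun x => measure_ge0 _ _).
apply: eq_measurable_fun => a _; rewrite /fubini_F integral_occ.
by rewrite patchE mem_set.
Qed.

(* For fixed [w], Tonelli turns the average over [a] of the occupation times of
   the bands of radius [eta] around [a] into the integral over [s] of the
   length [2 * eta] of the set of levels [a] within [eta] of [Y s w]. *)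
Lemma occupation_average (eps eta : R) : 0 < eta -> eta <= eps ->
  ((2 * eta)%:E * \int[P]_(w in A) mu (occupation_set eps 0 w) <=
   \int[mu]_(a in `[(- (2 * eps))%R, (2 * eps)%R])
      \int[P]_(w in A) mu (occupation_set eta a w))%E.
Proof.
move=> eta0 etaeps.
set I := `[_, _]%classic.
have mI : measurable I by exact: measurable_itv.
pose N q := mu (xsection (bandX I eta) q).
have mN : measurable_fun [set: R * T] N by exact: measurable_occ_pair.
have -> : (\int[mu]_(a in I) \int[P]_(w in A) mu (occupation_set eta a w) =
    \int[mu]_a \int[P]_w N (a, w))%E.
  by rewrite [LHS]integral_mkcond; apply: eq_integral => a _; rewrite -integral_occ.
rewrite (@fubini_tonelli _ _ _ _ _ mu P N mN (fun x => measure_ge0 _ _)).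
rewrite -ge0_integralZl_EFin//; last 2 first.
- exact: measurable_funTS (measurable_occupation _ _).
- by rewrite mulr_ge0// ltW.
rewrite [leLHS]integral_mkcond; apply: ge0_le_integral => //.
- move=> w _; rewrite patchE; case: ifP => // _.
  by rewrite mule_ge0// lee_fin mulr_ge0// ltW.
- apply/(measurable_restrictT _ mA).
  by apply: measurable_funeM; exact: measurable_funTS (measurable_occupation _ _).
- exact: (@measurable_fun_fubini_tonelli_G _ _ _ _ _ mu _ mN (fun x => measure_ge0 _ _)).
move=> w _; rewrite patchE; case: ifPn => [wA|_]; last first.
  by apply: integral_ge0 => a _; exact: measure_ge0.
pose E : set (R * R) := [set q | bandX I eta ((q.1, w), q.2)].
have mE : measurable E.
  have mq : measurable_fun [set: R * R] (fun q => ((q.1, w), q.2)).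
    apply: measurable_fun_pair => //.
    by apply: measurable_fun_pair => //; exact: measurable_fst.
  by rewrite -[X in measurable X]setTI; apply: mq => //; exact: measurable_bandX.
have -> : (\int[mu]_a N (a, w) = \int[mu]_a mu (xsection E a))%E by [].
rewrite integral_xsection_ysection// -(setIT (occupation_set _ _ _)).
rewrite -integral_indic//; last exact: measurable_occupation_set.
rewrite -ge0_integralZl_EFin//; last 2 first.
- by apply/measurable_EFinP/measurable_indic; exact: measurable_occupation_set.
- by rewrite mulr_ge0// ltW.
apply: ge0_le_integral => //.
- by move=> s _; rewrite mule_ge0// lee_fin// mulr_ge0// ltW.
- apply: measurable_funeM; apply/measurable_EFinP/measurable_indic.
  exact: measurable_occupation_set.
- exact: measurable_fun_ysection.
move=> s _; rewrite indicE; case: (boolP (s \in _)) => [/set_mem|_]; last first.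
  by rewrite mule0.
rewrite mule1 => -[Ss /= Ys].
(* Every level within [eta] of [Y s w] belongs to [I], since [|Y s w| < eps] and [eta <= eps]; hence
   the section is a full interval of length [2 * eta]. *)
have -> : ysection E s = `](Y s w - eta), (Y s w + eta)[%classic.
  apply/seteqP; split=> a; rewrite /ysection/= in_itv/=.
    by move=> /set_mem[/= _ [_ [_]]]; rewrite distrC ltr_distl.
  move=> ha; apply/mem_set; split=> /=; last first.
    split; first exact/set_mem.
    by split=> //; rewrite distrC ltr_distl.
  move: Ys ha; rewrite /I subr0 ltr_norml /= in_itv/= => /andP[? ?] /andP[? ?].
  by apply/andP; split; lra.
rewrite lebesgue_measure_itv/= lte_fin; case: ifPn => h.
  by rewrite -EFinB lee_fin; lra.
by exfalso; move/negP: h; apply; lra.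
Qed.

(** By Tonelli, the small-ball bound is integrated over the times in [S]. After division by
    [2 * eta] the bound is uniform in level and width, which supplies the domination below. *)
Lemma integral_occupation_le (eta a K : R) : 0 <= K ->
  (forall s, S s -> (P [set w | (`|Y s w - a| < eta)%R] <= (2 * eta * K)%:E)%E) ->
  (\int[P]_(w in A) mu (occupation_set eta a w) <= (2 * eta * K)%:E * mu S)%E.
Proof.
move=> K0 HK.
pose E : set (T * R) := band eta a `&` (A `*` setT).
have mE : measurable E by apply: measurableI => //; exact: measurableX.
have -> : (\int[P]_(w in A) mu (occupation_set eta a w) =
    \int[P]_w mu (xsection E w))%E.
  rewrite [LHS]integral_mkcond; apply: eq_integral => w _; rewrite patchE.
  case: ifPn => wA; last first.
    rewrite (_ : xsection E w = set0) ?measure0//.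
    apply/seteqP; split=> s //; rewrite /xsection/= => /set_mem[_ [/= Aw _]].
    by move: wA; rewrite mem_set.
  congr (mu _); apply/seteqP; split=> s; rewrite /xsection/=.
    by move=> Hs; apply/mem_set; split=> //; split=> //; exact: set_mem.
  by move=> /set_mem[].
rewrite integral_xsection_ysection// -(integral_cst mu mS).
rewrite [leRHS]integral_mkcond; apply: ge0_le_integral => //.
- exact: measurable_fun_ysection.
- by apply/(measurable_restrictT _ mS); exact: measurable_cst.
move=> s _; rewrite patchE; case: ifPn => sS.
  apply: le_trans (HK s (set_mem sS)); rewrite le_measure ?inE//.
  - exact: measurable_ysection.
  - rewrite (_ : [set w | _] = ysection (band eta a) s); first exact: measurable_ysection.
    apply/seteqP; split=> w; rewrite /ysection/=.
      by move=> Hw; apply/mem_set; split=> //; exact: set_mem.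
    by move=> /set_mem[].
  - by move=> w; rewrite /ysection/= => /set_mem[[]].
rewrite (_ : ysection E s = set0) ?measure0//.
apply/seteqP; split=> w //; rewrite /ysection/= => /set_mem[[/= Ss _] _].
by move: sS; rewrite mem_set.
Qed.

End occupation_average.

(** The normalised occupation times [h n a] are averaged over the levels [|a| <= 2 * eps], an
    interval of length [4 * eps]. Their upper bounds [c + e n a] tend to [c] at each level, and [K]
    dominates them. *)
Lemma occupation_le_of_levels (R : realType) (d : measure_display)
    (T : measurableType d) (P : probability T R) (Y : R -> T -> R) (S : set R)
    (A : set T) (K c eps : R) (eta : nat -> R) (e : nat -> R -> \bar R) :
  measurable_fun [set: R * T] (fun p => Y p.1 p.2) ->
  measurable S -> measurable A -> (lebesgue_measure S <= 1)%E ->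
  0 <= K -> 0 <= c -> 0 < eps ->
  (forall n, 0 < eta n <= eps) ->
  (forall n a s, S s ->
    (P [set w | (`|Y s w - a| < eta n)%R] <= (2 * eta n * K)%:E)%E) ->
  (forall n a, 0 <= e n a)%E ->
  (forall a, `|a| <= 2 * eps -> e ^~ a @ \oo --> 0%E) ->
  (forall n a, `|a| <= 2 * eps ->
    (\int[P]_(w in A) lebesgue_measure (occupation_set Y S (eta n) a w) <=
     (2 * eta n)%:E * (c%:E + e n a))%E) ->
  (\int[P]_(w in A) lebesgue_measure (occupation_set Y S eps 0 w) <=
   (4 * eps * c)%:E)%E.
Proof.
move=> mY mS mA S1 K0 c0 eps0 etaP HK ege0 e0 He.
set X := (X in (X <= _)%E).
pose mu := @lebesgue_measure R.
pose I := `[(- (2 * eps)), (2 * eps)]%classic.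
have mI : measurable I by exact: measurable_itv.
have IP a : I a -> `|a| <= 2 * eps.
  by rewrite /I/= in_itv/= ler_norml.
pose h n a := ((2 * eta n)^-1%:E *
  \int[P]_(w in A) mu (occupation_set Y S (eta n) a w))%E.
have mh n : measurable_fun setT (h n).
  by apply: measurable_funeM; exact: measurable_integral_occupation.
have h0 n a : (0 <= h n a)%E.
  have /andP[en0 _] := etaP n.
  rewrite mule_ge0//; first by rewrite lee_fin invr_ge0 mulr_ge0// ltW.
  by apply: integral_ge0 => w _; exact: measure_ge0.
(* Only upper bounds on [h] are known, so [h] may fail to converge; the maximum with [c] is squeezed
   between [c] and [c + e n a] and does converge. *)
pose F n a := maxe (h n a) c%:E.
have mF n : measurable_fun I (F n).
  by apply: measurable_maxe; [exact: measurable_funTS|exact: measurable_cst].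
have XF n : (X <= \int[mu]_(a in I) F n a)%E.
  have /andP[en0 enle] := etaP n.
  apply: (@le_trans _ _ (\int[mu]_(a in I) h n a)%E).
    rewrite ge0_integralZl_EFin//; last 3 first.
    - by move=> a _; apply: integral_ge0 => w _; exact: measure_ge0.
    - by apply: measurable_funTS; exact: measurable_integral_occupation.
    - by rewrite invr_ge0 mulr_ge0// ltW.
    rewrite lee_pdivlMl ?mulr_gt0//; apply: (occupation_average P mY mS mA en0 enle).
  apply: ge0_le_integral => //.
  - by apply: measurable_funTS; exact: mh.
  - exact: mF.
  by move=> a _; rewrite /F le_max lexx.
have Fc a : I a -> F ^~ a @ \oo --> c%:E.
  move=> /IP Ia.
  apply: (@squeeze_cvge _ _ _ _ (fun=> c%:E) _ (fun n => c%:E + e n a)%E).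
  - apply: nearW => n; rewrite /F le_max lexx orbT/= ge_max.
    have /andP[en0 _] := etaP n.
    have hle : (h n a <= c%:E + e n a)%E.
      by rewrite /h lee_pdivrMl ?mulr_gt0// He.
    by rewrite hle leeDl.
  - exact: cvg_cst.
  - rewrite -[X in _ --> X]adde0; apply: cvgeD => //; [exact: cvg_cst|exact: e0].
have muI : mu I = (4 * eps)%:E.
  rewrite /mu /I lebesgue_measure_itv/= lte_fin ifT; last lra.
  by rewrite -EFinB; congr EFin; ring.
have hK n a : (h n a <= K%:E)%E.
  have /andP[en0 _] := etaP n.
  rewrite /h lee_pdivrMl ?mulr_gt0// -EFinM.
  apply: (le_trans (integral_occupation_le mY mS mA K0 (HK n a))).
  by rewrite -[leRHS]mule1 lee_wpmul2l// lee_fin !mulr_ge0// ltW.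
have cF : (\int[mu]_(a in I) F n a)%E @[n --> \oo] --> (\int[mu]_(a in I) (cst c%:E a))%E.
  apply: (@dominated_cvg _ _ _ mu I mI F (cst c%:E) (cst (Num.max K c)%:E)) => //.
  - apply/integrableP; split; first exact: measurable_cst.
    rewrite (eq_integral (cst (Num.max K c)%:E)).
      by rewrite integral_cst//= (muI : lebesgue_measure I = _) -EFinM ltry.
    by move=> b _ /=; rewrite ger0_norm// le_max K0.
  - move=> m b _ /=; rewrite gee0_abs ?le_max ?h0//.
    by rewrite /F EFin_max ge_max !le_max hK lexx orbT.
have : (X <= \int[mu]_(a in I) (cst c%:E a))%E.
  by apply: (cvge_ge _ cF); apply: nearW.
by rewrite integral_cst//= (muI : lebesgue_measure I = _) -EFinM mulrC.
Qed.

(** * Brownian motion along a curve *)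

(** The comparison is made on the simple functions below [f], so that it covers functions of unknown
    measurability, such as the uncountable supremum over [t] in [lt_cvg]. *)
Lemma ge0_le_integralT (d : measure_display) (T : measurableType d)
    (R : realType) (mu : {measure set T -> \bar R}) (f g : T -> \bar R) :
  (forall x, 0 <= f x)%E -> (forall x, f x <= g x)%E ->
  (\int[mu]_x f x <= \int[mu]_x g x)%E.
Proof.
move=> f0 fg; have g0 x : (0 <= g x)%E := le_trans (f0 x) (fg x).
rewrite !ge0_integralTE//; apply: le_ereal_sup => _ [h hf <-].
by exists h => // x; exact: le_trans (hf x) (fg x).
Qed.

Lemma dist_clip01_le (R : realType) (s t : R) :
  `|Num.max 0 (Num.min s 1) - Num.max 0 (Num.min t 1)| <= `|s - t|.
Proof.
suff H (r : R) : t - s <= r -> s - t <= r ->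
    `|Num.max 0 (Num.min s 1) - Num.max 0 (Num.min t 1)| <= r.
  by apply: H; [rewrite distrC|]; exact: ler_norm.
move=> rs rt; rewrite ler_norml.
have m01 : Num.max 0 1 = 1 :> R by rewrite max_r.
have [?|?] := leP s 1; have [?|?] := leP t 1; rewrite ?m01.
- by have [?|?] := leP 0 s; have [?|?] := leP 0 t; apply/andP; split; lra.
- by have [?|?] := leP 0 s; apply/andP; split; lra.
- by have [?|?] := leP 0 t; apply/andP; split; lra.
- by apply/andP; split; lra.
Qed.

Lemma holder_ball_clip_continuous (R : realType) (alpha : R) (f : R -> R) :
  0 < alpha -> holder_ball alpha f ->
  continuous (fun t : R => f (Num.max 0 (Num.min t 1))).
Proof.
move=> a0 [_ Hf] t.
have clip01 (s : R) : Num.max 0 (Num.min s 1) \in `[0, 1].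
  by rewrite in_itv/= le_max lexx/= ge_max ler01/= ge_min lexx orbT.
apply/cvgrPdist_lt => e e0.
have d0 : 0 < e `^ alpha^-1 by rewrite powR_gt0.
near=> s.
apply: (le_lt_trans (Hf _ _ (clip01 t) (clip01 s))).
rewrite [ltRHS](_ : _ = (e `^ alpha^-1) `^ alpha); last first.
  by rewrite -powRrM mulVf ?gt_eqF// powRr1// ltW.
apply: gt0_ltr_powR; rewrite ?nnegrE ?powR_ge0//.
apply: le_lt_trans (dist_clip01_le t s) _.
by near: s; apply/nbhs_ballP; exists (e `^ alpha^-1).
Unshelve. all: by end_near. Qed.

Section occupation_brownian.
Context (R : realType) (alpha : R) (d : measure_display).
Context (T : measurableType d) (P : probability T R) (W : R -> T -> R).
Hypothesis alpha_gt0 : 0 < alpha.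
Hypothesis hW : brownian_motion P W.

Local Notation mu := (@lebesgue_measure R).

(* The clamping of the time argument only makes the process total and jointly
   measurable: on [0, 1] this is [W s w - f s]. *)
Definition offset (f : R -> R) (s : R) (w : T) : R :=
  W (Num.max 0 s) w - f (Num.max 0 (Num.min s 1)).

Lemma measurable_offset f : holder_ball alpha f ->
  measurable_fun [set: R * T] (fun p => offset f p.1 p.2).
Proof.
move=> hf; apply: measurable_funB.
  apply: measurable_fun_continuous_process; first exact: (bm_measurable hW).
  exact: (brownian_continuous_max hW).
apply: (measurableT_comp (f := fun t : R => f (Num.max 0 (Num.min t 1)))).
  apply: continuous_measurable_fun.
  exact: (holder_ball_clip_continuous alpha_gt0 hf).
exact: measurable_fst.
Qed.

(** The density of [W s] is at most its peak, which decreases in the variance [s]. The peak blows up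
    at time 0, which is why occupation is counted from time [kappa] on. *)
Lemma brownian_small_ball (kappa s x eta : R) : 0 < kappa -> kappa <= s ->
  0 < eta ->
  (P [set w | (`|W s w - x| < eta)%R] <=
   (2 * eta * normal_peak (Num.sqrt kappa))%:E)%E.
Proof.
move=> k0 ks eta0; have s0 : 0 < s := lt_le_trans k0 ks.
have mWs : measurable_fun setT (W s) by apply: (bm_measurable hW); exact: ltW.
have mW0 : measurable_fun setT (W 0) by apply: (bm_measurable hW).
pose B := `](x - eta), (x + eta)[%classic.
have mB : measurable B by exact: measurable_itv.
have mE : measurable [set w | `|W s w - x| < eta].
  rewrite (_ : [set w | _] = W s @^-1` B).
    by rewrite -[X in measurable X]setTI; exact: mWs.
  by apply/seteqP; split=> w; rewrite /B/= in_itv/= ltr_distl.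
have mE' : measurable [set w | `|W s w - W 0 w - x| < eta].
  have mf : measurable_fun setT (fun w => W s w - W 0 w) by exact: measurable_funB.
  rewrite (_ : [set w | _] = (fun w => W s w - W 0 w) @^-1` B).
    by rewrite -[X in measurable X]setTI; exact: mf.
  by apply/seteqP; split=> w; rewrite /B/= in_itv/= ltr_distl.
(* The Gaussian law is given for increments, so [W s] is replaced by [W s - W 0] off the null set
   where [W 0] is not 0. *)
have [N [mN PN0 WN]] := bm_start hW.
apply: (@le_trans _ _ (P ([set w | `|W s w - W 0 w - x| < eta] `|` N))).
  rewrite le_measure ?inE//; first exact: measurableU.
  move=> w /= Ew; have [w0|w0] := eqVneq (W 0 w) 0; first by left; rewrite w0 subr0.
  by right; apply: WN => /= h; rewrite h eqxx in w0.
rewrite measureU0//.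
have PE : P [set w | `|W s w - W 0 w - x| < eta] =
    normal_prob 0 (Num.sqrt (s - 0)) B.
  rewrite -(bm_gaussian_increments hW (lexx 0) s0 mB) /pushforward; congr (P _).
  by apply/seteqP; split=> w; rewrite /B/= in_itv/= ltr_distl.
rewrite [leLHS]PE subr0 /normal_prob.
have sq0 : 0 < Num.sqrt s by rewrite sqrtr_gt0.
have kq0 : 0 < Num.sqrt kappa by rewrite sqrtr_gt0.
apply: (@le_trans _ _ (\int[mu]_(y in B) (cst (normal_peak (Num.sqrt kappa))%:E y))%E).
  apply: ge0_le_integral => //.
  - by move=> y _; rewrite lee_fin normal_pdf_ge0.
  - by apply: measurable_funTS; apply/measurable_EFinP; exact: measurable_normal_pdf.
  move=> y _; rewrite lee_fin; apply: (le_trans (normal_pdf_ub _ _ _)).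
    by rewrite gt_eqF.
  rewrite /normal_peak (sqr_sqrtr (ltW s0)) (sqr_sqrtr (ltW k0)).
  have pos (z : R) : 0 < z -> 0 < z * pi *+ 2.
    by move=> z0; rewrite mulrn_wgt0// mulr_gt0// pi_gt0.
  rewrite lef_pV2 ?posrE ?sqrtr_gt0 ?pos// ler_sqrt; last exact/ltW/pos.
  by rewrite lerMn2r ler_pM2r ?pi_gt0.
rewrite integral_cst//= [X in (_ * X)%E](_ : _ = (2 * eta)%:E).
  by rewrite -EFinM mulrC.
rewrite (lebesgue_measure_itv `](x - eta), (x + eta)[) /= lte_fin ifT; last lra.
by rewrite -EFinB; congr EFin; lra.
Qed.

End occupation_brownian.

(** * Occupation times controlled by local times *)

Section local_time_bound.
Context (R : realType) (alpha : R) (d : measure_display).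
Context (T : measurableType d) (P : probability T R) (W : R -> T -> R).
Hypothesis alpha_gt0 : 0 < alpha.
Hypothesis hW : brownian_motion P W.

Local Notation mu := (@lebesgue_measure R).

Lemma occupation_density1E (g : R -> R) (eta : R) (w : T) :
  holder_ball alpha g ->
  occupation_density W g eta 1 w =
    (2 * eta)^-1 * fine (mu (occupation_set (offset W g) `[0, 1] eta 0 w)).
Proof.
move=> hg; rewrite /occupation_density /Rintegral; congr (_ * fine _).
set O := occupation_set _ _ _ _ _.
have mO : measurable O.
  by apply: measurable_occupation_set => //; exact: (measurable_offset alpha_gt0 hW hg).
have mI : measurable (`[0, 1]%classic : set R) by exact: measurable_itv.
transitivity (\int[mu]_(s in `[0%R, 1%R]) (\1_O s)%:E)%E; last first.
  by rewrite integral_indic//; congr (mu _); apply/setIidPl => s [].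
apply: eq_integral => s /set_mem/= s01; congr EFin.
have [s0 s1] : 0 <= s /\ s <= 1 by move: s01; rewrite in_itv/= => /andP.
rewrite !indicE; congr (nat_of_bool _)%:R; apply/idP/idP.
  move/set_mem; rewrite /= in_itv/= -ltr_distl => h; apply/mem_set; split=> //=.
  by rewrite /offset subr0 max_r// min_l// max_r.
move/set_mem => [_ /=]; rewrite /offset subr0 max_r// min_l// max_r// => h.
by apply/mem_set; rewrite /= in_itv/= -ltr_distl.
Qed.

(** The occupation time is at most [2 * eta] times the density [D] at time 1. Bounding [D - L] by
    [1 + (D - L)^2] lets the mean-square convergence enter directly, at the price of replacing [M]
    by [M + 1]. *)
Lemma local_time_level_bound (g : R -> R) (L : R -> T -> R)
    (kappa eta M : R) (A : set T) :
  holder_ball alpha g -> local_time P W g L -> measurable A -> 0 <= M ->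
  P (A `&` [set w | M < L 1 w]) = 0%E -> 0 < kappa -> 0 < eta ->
  (\int[P]_(w in A) mu (occupation_set (offset W g) `[kappa, 1%R] eta 0 w) <=
   (2 * eta)%:E * (((M + 1) * fine (P A))%:E +
     \int[P]_w ereal_sup [set (`|occupation_density W g eta t w - L t w| ^+ 2)%:E
                         | t in `[0%R, 1%R]]))%E.
Proof.
move=> hg hL mA M0 LM k0 eta0.
have mY := measurable_offset alpha_gt0 hW hg.
have mI (a : R) : measurable (`[a, 1]%classic : set R) by exact: measurable_itv.
have one01 : (1 : R) \in `[0, 1] by rewrite in_itv/= ler01 lexx.
have mL : measurable_fun setT (L 1) by apply: (lt_measurable hL).
have eta20 : 0 < 2 * eta by rewrite mulr_gt0.
pose O (a : R) w := occupation_set (offset W g) `[a, 1] eta 0 w.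
have mO a w : measurable (O a w) by exact: measurable_occupation_set.
have mOf a : measurable_fun setT (fun w => mu (O a w)).
  by apply: measurable_occupation.
pose D := occupation_density W g eta 1.
have O01 w : (mu (O 0%R w) <= 1)%E.
  apply: (@le_trans _ _ (mu `[0%R, 1%R]%classic)).
    by apply: le_measure; rewrite ?inE; [exact: mO|exact: mI|move=> s []].
  by rewrite lebesgue_measure_itv/= lte_fin ltr01 sube0.
have O0fin w : mu (O 0%R w) \is a fin_num.
  by rewrite ge0_fin_numE// (le_lt_trans (O01 w))// ltry.
have Ok w : (mu (O kappa w) <= (2 * eta)%:E * (D w)%:E)%E.
  rewrite /D occupation_density1E// -EFinM mulrA mulfV ?gt_eqF// mul1r (fineK (O0fin w)).
  apply: le_measure; rewrite ?inE; [exact: mO|exact: mO|].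
  move=> s [/= sk h]; split=> //=; move: sk; rewrite !in_itv/= => /andP[ks ->].
  by rewrite (le_trans (ltW k0)).
have mD : measurable_fun setT D.
  rewrite (_ : D = fun w => (2 * eta)^-1 * fine (mu (O 0%R w))); last first.
    by apply/funext => w; exact: occupation_density1E.
  by apply: measurable_funM => //; apply: (measurableT_comp (f := fine)).
pose Q w := (`|D w - L 1 w| ^+ 2)%:E.
have mQ : measurable_fun setT Q.
  apply/measurable_EFinP; apply: measurable_funX.
  by apply: measurableT_comp; [exact: normr_measurable|exact: measurable_funB].
have Q0 w : (0 <= Q w)%E by rewrite lee_fin exprn_ge0.
have M10 : 0 <= M + 1 by rewrite addr_ge0.
apply: (@le_trans _ _ (\int[P]_(w in A) ((2 * eta)%:E * ((M + 1)%:E + Q w)))%E).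
  apply: ae_ge0_le_integral => //.
  - by apply: measurable_funTS; exact: mOf.
  - by move=> w _; apply: mule_ge0; [rewrite lee_fin ltW|exact: adde_ge0].
  - apply: measurable_funTS; apply: measurable_funeM.
    by apply: emeasurable_funD => //; exact: measurable_cst.
  exists (A `&` [set w | M < L 1 w]); split=> //.
    apply: measurableI => //.
    rewrite (_ : [set w | _] = L 1 @^-1` `]M, +oo[).
      by rewrite -[X in measurable X]setTI; exact: mL.
    by apply/seteqP; split=> w /=; rewrite in_itv/= andbT.
  move=> w /= nle; apply: contrapT => nA; apply: nle => Aw.
  have LMw : L 1 w <= M.
    by rewrite leNgt; apply/negP => h; apply: nA; split.
  apply: (le_trans (Ok w)); apply: lee_wpmul2l; first by rewrite lee_fin ltW.
  (* [D <= L + |D - L| <= M + 1 + (D - L)^2] *)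
  rewrite /Q -EFinD lee_fin real_normK ?num_real//.
  by have := sqr_ge0 (D w - L 1 w - 2^-1); move: LMw; nra.
rewrite ge0_integralZl_EFin//; last 3 first.
- by move=> w _; rewrite adde_ge0.
- by apply: measurable_funTS; apply: emeasurable_funD => //; exact: measurable_cst.
- exact: ltW.
apply: lee_wpmul2l; first by rewrite lee_fin ltW.
rewrite ge0_integralD//; last exact: measurable_funTS.
rewrite leeD//.
  rewrite (integral_cst P mA (M + 1)%:E) EFinM fineK// fin_num_measure//.
(* The domain is enlarged from [A] to the whole space; then [Q] is the member [t = 1] of the
   supremum. *)
apply: (@le_trans _ _ (\int[P]_w Q w)%E); first exact: ge0_subset_integral.
apply: ge0_le_integralT => // w; apply: ereal_sup_ubound; exists 1 => //.
Qed.

End local_time_bound.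

Section occupation_of_bounded_local_times.
Context (R : realType) (alpha : R) (d : measure_display).
Context (T : measurableType d) (P : probability T R) (W : R -> T -> R).
Context (L : (R -> R) -> R -> T -> R).
Hypothesis alpha_gt0 : 0 < alpha.
Hypothesis hW : brownian_motion P W.
Hypothesis hL : forall f, holder_ball alpha f -> local_time P W f (L f).

Local Notation mu := (@lebesgue_measure R).

(** Curves bounded by 1/2 leave room in the ball for vertical translates by at most 1/2. *)
Lemma holder_ball_shift (f : R -> R) (a : R) : holder_ball alpha f ->
  (forall t, t \in `[0, 1] -> `|f t| <= 2^-1) -> `|a| <= 2^-1 ->
  holder_ball alpha (fun t => f t + a).
Proof.
move=> [_ hf] f2 a2; split=> [t t01|s t s01 t01].
  by rewrite (le_trans (ler_normD _ _))// (splitr 1) div1r lerD// f2.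
rewrite (_ : f s + a - (f t + a) = f s - f t); last by ring.
exact: hf.
Qed.

Lemma local_time_cvg_seq (f : R -> R) (Lf : R -> T -> R) (eta : nat -> R) :
  local_time P W f Lf -> (forall n, 0 < eta n) -> eta @ \oo --> 0 ->
  (\int[P]_w ereal_sup [set (`|occupation_density W f (eta n) t w - Lf t w| ^+ 2)%:E
                       | t in `[0%R, 1%R]])%E @[n --> \oo] --> 0%E.
Proof.
move=> hf eta0 etac.
have etar : eta @ \oo --> 0^'+.
  move=> U U0.
  have nU : \forall n \near \oo, 0 < eta n -> U (eta n) by exact: etac _ U0.
  by suff: \forall n \near \oo, U (eta n) by []; apply: filterS nU => n; apply.
exact: (cvg_comp _ _ etar (lt_cvg hf)).
Qed.

(** Let [A] be the exceptional event. Averaging over levels bounds the integral over [A] of the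
    occupation time by [4 * eps * (M + 1) * P A], whereas the definition of [A] bounds it below by
    [4 * eps * (M + 2) * P A]; hence [P A = 0]. The condition [eps <= 1/4] keeps all translates by
    at most [2 * eps] in the ball. *)
Lemma occupation_of_bounded_local_times (B : set T) (M : R) (f : R -> R)
    (kappa eps : R) :
  measurable B -> 0 <= M ->
  (forall g, holder_ball alpha g -> P (B `&` [set w | M < L g 1 w]) = 0%E) ->
  holder_ball alpha f -> (forall t, t \in `[0, 1] -> `|f t| <= 2^-1) ->
  0 < kappa <= 1 -> 0 < eps <= 4^-1 ->
  P.-negligible (B `&` [set w | ((4 * eps * (M + 2))%:E <
    mu (occupation_set (offset W f) `[kappa, 1%R] eps 0 w))%E]).
Proof.
move=> mB M0 HB hf f2 /andP[k0 k1] /andP[e0 e4].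
have mY := measurable_offset alpha_gt0 hW hf.
have mS : measurable (`[kappa, 1]%classic : set R) by exact: measurable_itv.
set A := B `&` _.
pose c0 : R := 4 * eps * (M + 2).
have mOf (a : R) eta : measurable_fun setT
    (fun w => mu (occupation_set (offset W f) `[kappa, 1] eta a w)).
  exact: measurable_occupation.
have mA : measurable A.
  apply: measurableI => //.
  rewrite (_ : [set w | _] =
    (fun w => mu (occupation_set (offset W f) `[kappa, 1] eps 0 w)) @^-1` `]c0%:E, +oo%E]).
    by rewrite -[X in measurable X]setTI; apply: mOf => //; exact: emeasurable_itv.
  by apply/seteqP; split=> w /=; rewrite in_itv/= leey andbT.
have PAfin : P A \is a fin_num by exact: fin_num_measure.
pose c := (M + 1) * fine (P A).
have c0_ge0 : 0 <= c by rewrite mulr_ge0 ?fine_ge0// addr_ge0.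
pose K := normal_peak (Num.sqrt kappa).
pose eta (n : nat) : R := eps / n.+1%:R.
have eta0 n : 0 < eta n by rewrite divr_gt0.
have etac : eta @ \oo --> 0.
  rewrite -[X in _ --> X](mulr0 eps); apply: cvgMr => //; exact: cvg_harmonic.
pose sh (a : R) := fun t => f t + a.
have hsh a : `|a| <= 2 * eps -> holder_ball alpha (sh a).
  by move=> ha; apply: holder_ball_shift => //; rewrite (le_trans ha)//; lra.
pose e (n : nat) (a : R) : \bar R :=
  (\int[P]_w ereal_sup [set (`|occupation_density W (sh a) (eta n) t w - L (sh a) t w| ^+ 2)%:E
     | t in `[0%R, 1%R]])%E.
have ub : (\int[P]_(w in A) mu (occupation_set (offset W f) `[kappa, 1%R] eps 0 w) <=
   (4 * eps * c)%:E)%E.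
  apply: (@occupation_le_of_levels _ _ _ P _ _ _ K c eps eta e) => //.
  - rewrite (lebesgue_measure_itv `[kappa, 1])/= lte_fin; case: ifP => // _.
    by rewrite -EFinB lee_fin; lra.
  - exact: normal_peak_ge0.
  - move=> n; rewrite eta0/= /eta ler_pdivrMr//.
    by apply: ler_peMr; [exact: ltW|rewrite ler1n].
  - move=> n a s /= s01.
    have [ks s1] : kappa <= s /\ s <= 1 by move: s01; rewrite in_itv/= => /andP.
    have := brownian_small_ball hW (f s + a) k0 ks (eta0 n).
    congr (_ <= _)%E; congr (P _); apply/seteqP; split=> w /=;
      rewrite /offset (max_r (le_trans (ltW k0) ks)) (min_l s1)
        (max_r (le_trans (ltW k0) ks)) opprD addrA//.
  - move=> n a; apply: integral_ge0 => w _.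
    pose z : R := `|occupation_density W (sh a) (eta n) 0 w - L (sh a) 0 w| ^+ 2.
    apply: (@le_trans _ _ z%:E); first by rewrite lee_fin exprn_ge0.
    by apply: ereal_sup_ubound; exists 0%R => //=; rewrite in_itv/= lexx ler01.
  - move=> a ha; apply: local_time_cvg_seq => //; apply: hL; exact: hsh.
  - move=> n a ha.
    have Osh w : occupation_set (offset W f) `[kappa, 1] (eta n) a w =
        occupation_set (offset W (sh a)) `[kappa, 1] (eta n) 0 w.
      rewrite /occupation_set; congr (_ `&` _); apply/funext => s /=.
      by rewrite /offset /sh opprD addrA subr0.
    under eq_integral do rewrite Osh.
    apply: (local_time_level_bound alpha_gt0 hW (hsh _ ha)) => //; first exact/hL/hsh.
    apply/eqP; rewrite eq_le measure_ge0 andbT -[leRHS](HB _ (hsh _ ha)).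
    have mLs : measurable [set w | M < L (sh a) 1 w].
      have mL : measurable_fun setT (L (sh a) 1).
        by apply: (lt_measurable (hL (hsh _ ha))); rewrite in_itv/= ler01 lexx.
      rewrite (_ : [set w | _] = L (sh a) 1 @^-1` `]M, +oo[).
        by rewrite -[X in measurable X]setTI; exact: mL.
      by apply/seteqP; split=> w /=; rewrite in_itv/= andbT.
    apply: le_measure; rewrite ?inE; [exact: measurableI|exact: measurableI|].
    by move=> w [[Bw _] Lw].
have lb : (c0%:E * P A <=
    \int[P]_(w in A) mu (occupation_set (offset W f) `[kappa, 1%R] eps 0 w))%E.
  rewrite -(integral_cst P mA c0%:E); apply: ge0_le_integral => //.
  - by move=> w _; rewrite lee_fin !mulr_ge0 ?addr_ge0// ltW.
  - by apply: measurable_funTS; exact: mOf.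
  - by move=> w [_ /ltW].
have := le_trans lb ub; rewrite -(fineK PAfin) -EFinM lee_fin /c0 /c => h.
have PA0 : 0 <= fine (P A) by rewrite fine_ge0.
have PA : fine (P A) <= 0; last first.
  exists A; split=> //; rewrite -(fineK PAfin); congr EFin.
  by apply/eqP; rewrite eq_le PA PA0.
rewrite -(ler_pM2l (_ : 0 < 4 * eps)) ?mulr_gt0// mulr0.
lra.
Qed.
End occupation_of_bounded_local_times.

(** * Events on which all local times are bounded *)

Section bounded_local_times_negligible.
Context (R : realType) (alpha : R) (d : measure_display).
Context (T : measurableType d) (P : probability T R) (W : R -> T -> R).
Context (L : (R -> R) -> R -> T -> R).
Hypothesis halpha : 0 < alpha < 2^-1.
Hypothesis hW : brownian_motion P W.
Hypothesis hL : forall f, holder_ball alpha f -> local_time P W f (L f).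

Local Notation mu := (@lebesgue_measure R).

(** Stopping is a contraction of time, so it preserves the Hölder bound. *)
Lemma holder_ball_stopped_brownian (w : T) (delta : R) :
  W 0 w = 0 -> 0 < delta <= 1 ->
  (forall s t, s \in `[0, delta] -> t \in `[0, delta] ->
    `|W s w - W t w| <= `|s - t| `^ alpha) ->
  exists2 rho : R, 0 < rho <= 1 &
    (holder_ball alpha `&` [set f | forall t, t \in `[0, 1] -> `|f t| <= 2^-1])
      (fun t => W (Num.min t rho) w).
Proof.
have /andP[a0 _] := halpha.
move=> W0 /andP[d0 d1] Hd.
pose rho := Num.min delta (2^-1 `^ alpha^-1).
have r0 : 0 < rho by rewrite lt_min d0/= powR_gt0.
have rd : rho <= delta by rewrite ge_min lexx.
have itv t : t \in `[0, 1] -> Num.min t rho \in `[0, delta].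
  rewrite !in_itv/= => /andP[t0 _].
  by rewrite le_min t0 (ltW r0)/= ge_min rd orbT.
have half t : t \in `[0, 1] -> `|W (Num.min t rho) w| <= 2^-1.
  move=> t01; have z : (0 : R) \in `[0, delta] by rewrite in_itv/= lexx ltW.
  rewrite -[W _ _]subr0 -W0; apply: (le_trans (Hd _ _ (itv t t01) z)).
  rewrite [leRHS](_ : _ = (2^-1 `^ alpha^-1) `^ alpha); last first.
    by rewrite -powRrM mulVf ?gt_eqF// powRr1.
  apply: ge0_ler_powR; rewrite ?nnegrE ?powR_ge0 ?normr_ge0//; first exact: ltW.
  have := itv t t01; rewrite in_itv/= subr0 => /andP[m0 _].
  by rewrite ger0_norm// ge_min /rho (ge_min _ delta) lexx !orbT.
exists rho; first by rewrite r0 (le_trans rd).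
split=> //; split=> [t t01|s t s01 t01].
  by rewrite (le_trans (half t t01))// invf_le1// ler1n.
apply: (le_trans (Hd _ _ (itv s s01) (itv t t01))).
apply: ge0_ler_powR; rewrite ?nnegrE//; first exact: ltW.
suff H (r : R) : t - s <= r -> s - t <= r ->
    `|Num.min s rho - Num.min t rho| <= r.
  by apply: H; [rewrite distrC|]; exact: ler_norm.
move=> rs rt; rewrite ler_norml.
by have [?|?] := leP s rho; have [?|?] := leP t rho; apply/andP; split; lra.
Qed.

(** Outside countably many null events, a path in [B] spends at most [4 * eps * (M + 2)] in the band
    of each [F i], yet it spends more than [rho / 2] in the band of a curve approximating its own
    stopped path. *)
Lemma bounded_local_times_negligible (B : set T) (M : R) :
  measurable B -> 0 <= M ->
  (forall g, holder_ball alpha g -> P (B `&` [set w | M < L g 1 w]) = 0%E) ->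
  P B = 0%E.
Proof.
have /andP[a0 _] := halpha.
move=> mB M0 HB.
have half0 : (0 : R) <= 2^-1 by rewrite invr_ge0.
have [F [HF Fdense]] := exists_dense_seq_holder_ball a0 half0.
pose kappa (k : nat) : R := k.+1%:R^-1.
(* The shift by 4 ensures [eps j <= 1/4]. *)
pose eps (j : nat) : R := (j + 4)%:R^-1.
pose N i k j := B `&` [set w | ((4 * eps j * (M + 2))%:E <
    mu (occupation_set (offset W (F i)) `[kappa k, 1%R] (eps j) 0 w))%E].
have NN : P.-negligible (\bigcup_i \bigcup_k \bigcup_j N i k j).
  apply: negligible_bigcup => i; apply: negligible_bigcup => k.
  apply: negligible_bigcup => j.
  apply: (occupation_of_bounded_local_times a0 hW hL mB M0 HB (HF i).1 (HF i).2).
    by rewrite invr_gt0 ltr0n/= invf_le1 ?ltr0n// ler1n.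
  rewrite invr_gt0 ltr0n addn_gt0 orbT/=.
  by rewrite lef_pV2 ?posrE ?ltr0n ?addn_gt0 ?orbT// ler_nat leq_addl.
apply: measure_negligible => //.
have [N0 [mN0 PN0 WN0]] := bm_start hW.
have [N1 [mN1 PN1 WN1]] := brownian_holder_near0 hW halpha.
have nN0 : P.-negligible N0 by exists N0; split.
have nN1 : P.-negligible N1 by exists N1; split.
apply: negligibleS (negligibleU (negligibleU nN0 nN1) NN) => w Bw.
have [W0|] := eqVneq (W 0 w) 0; last first.
  by move=> /eqP W0; left; left; apply: WN0.
have [[delta d01 Hd]|nH] := pselect (exists2 delta : R, 0 < delta <= 1 &
    forall s t, s \in `[0, delta] -> t \in `[0, delta] ->
      `|W s w - W t w| <= `|s - t| `^ alpha); last first.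
  by left; right; apply: WN1.
right.
have [rho /andP[r0 r1] Hh] := holder_ball_stopped_brownian W0 d01 Hd.
have [k Hk] : exists k, kappa k < rho / 2.
  have r2 : 0 < rho / 2 by rewrite divr_gt0.
  have [n _ Hn] := near_infty_natSinv_lt (PosNum r2).
  by exists n; apply: Hn => /=.
have [j Hj] : exists j, 4 * eps j * (M + 2) < rho / 2.
  have M2 : 0 < M + 2 by rewrite ltr_wpDl.
  have e0 : 0 < rho / 2 / (4 * (M + 2)) by rewrite !divr_gt0// mulr_gt0.
  have [n _ Hn] := near_infty_natSinv_lt (PosNum e0).
  exists n; rewrite mulrAC -ltr_pdivlMl ?mulr_gt0// mulrC.
  apply: le_lt_trans (Hn n (leqnn n)).
  by rewrite /eps lef_pV2 ?posrE ?ltr0n ?addn_gt0 ?orbT// ler_nat -addn1 leq_add2l.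
have ej : 0 < eps j by rewrite invr_gt0 ltr0n addn_gt0 orbT.
(* The curve [F i] is chosen after [w], which is legitimate because the null event is a union over
   all [i], [k] and [j]. *)
have [i Hi] := Fdense _ Hh _ ej.
exists i => //; exists k => //; exists j => //; split=> //=.
have k0 : 0 < kappa k by rewrite invr_gt0.
have sub : `[kappa k, rho]%classic `<=`
    occupation_set (offset W (F i)) `[kappa k, 1] (eps j) 0 w.
  move=> s /=; rewrite in_itv/= => /andP[ks sr].
  have s0 : 0 <= s := le_trans (ltW k0) ks.
  have s1 : s <= 1 := le_trans sr r1.
  have s01 : s \in `[0, 1] by rewrite in_itv/= s0.
  split; first by rewrite /= in_itv/= ks.
  have := Hi s s01; rewrite (min_l sr) distrC /= /offset subr0.
  by rewrite (max_r s0) (min_l s1) (max_r s0).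
(* The interval has length [rho - kappa k > rho / 2], which exceeds [4 * eps j * (M + 2)] by the
   choice of [j]. *)
apply: (@lt_le_trans _ _ (mu `[kappa k, rho]%classic)).
  rewrite lebesgue_measure_itv/= lte_fin ifT; last by lra.
  by rewrite -EFinB lte_fin; lra.
apply: le_measure; rewrite ?inE; [exact: measurable_itv| |exact: sub].
apply: measurable_occupation_set; first exact: (measurable_offset a0 hW (HF i).1).
exact: measurable_itv.
Qed.

End bounded_local_times_negligible.

(** * Assembling the countable family *)

Theorem theorem3p8 (R : realType) (alpha : R) (halpha : 0 < alpha < 2^-1)
    (d : measure_display) (T : measurableType d) (P : probability T R)
    (W : R -> T -> R) (hW : brownian_motion P W)
    (L : (R -> R) -> R -> T -> R)
    (hL : forall f, holder_ball alpha f -> local_time P W f (L f)) :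
  exists F : set (R -> R),
    [/\ countable F,
        F `<=` holder_ball alpha &
        {ae P, forall w, ereal_sup [set (L f 1 w)%:E | f in F] = +oo%E}].
Proof.
have /andP[a0 _] := halpha.
pose E (m : nat) (g : R -> R) : set T := [set w | L g 1 w <= m%:R].
have mE m g : holder_ball alpha g -> measurable (E m g).
  move=> hg; have mL : measurable_fun setT (L g 1).
    by apply: (lt_measurable (hL _ hg)); rewrite in_itv/= ler01 lexx.
  rewrite (_ : E m g = L g 1 @^-1` `]-oo, m%:R]).
    by rewrite -[X in measurable X]setTI; exact: mL.
  by apply/seteqP; split=> w /=; rewrite in_itv.
have ne : @holder_ball R alpha !=set0.
  exists (cst 0); split=> [t _|s t _ _]; first by rewrite normr0.
  by rewrite subrr normr0 powR_ge0.
have /choice[G HG] : forall m, exists G : nat -> R -> R,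
    (forall k, holder_ball alpha (G k)) /\
    forall g, holder_ball alpha g -> P ((\bigcap_k E m (G k)) `\` E m g) = 0%E.
  by move=> m; apply: exists_countable_ess_bigcap => // g; exact: mE.
exists (range (fun p : nat * nat => G p.1 p.2)); split.
- exact: card_le_trans (card_image_le _ _) (countableP _).
- by move=> _ [[m k] _ <-]; exact: (HG m).1.
have mB m : measurable (\bigcap_k E m (G m k)).
  by apply: bigcap_measurableType => k _; apply: mE; exact: (HG m).1.
have PB m : P.-negligible (\bigcap_k E m (G m k)).
  apply/negligibleP => //.
  apply: (bounded_local_times_negligible (alpha := alpha) (M := m%:R) halpha hW hL) => //.
  (* Removing [E m g] from the intersection leaves exactly the part where [L g 1] exceeds [m]. *)
  move=> g hg; rewrite -[RHS]((HG m).2 g hg); congr (P _).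
  apply/seteqP; split=> w /= [Bw]; rewrite /E/=.
    by move=> lt; split=> //; apply/negP; rewrite -ltNge.
  by move=> /negP; rewrite -ltNge.
apply: negligibleS (negligible_bigcup PB) => w /= nsup.
apply: contrapT => nB; apply: nsup; apply/eqyP => x x0.
(* An integer above [x]: outside the null event for [m], some curve [G m k] has local time larger
   than [m]. *)
pose m := (Num.trunc x).+1.
have [k nE] : exists k, ~ E m (G m k) w.
  apply: contrapT => nk; apply: nB; exists m => // k _.
  by apply: contrapT => nE; apply: nk; exists k.
apply: (@le_trans _ _ (L (G m k) 1 w)%:E).
  move/negP: nE; rewrite /E/= -ltNge lee_fin => /ltW; apply: le_trans.
  by rewrite ltW// truncnS_gt.
by apply: ereal_sup_ubound; exists (G m k) => //; exists (m, k).
Qed.
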